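(* Let $1<p<q<\infty$ and $\theta>1$. Let $v,w$ be nonnegative measurable functions on $\mathbb{R}^m\times\mathbb{R}^n$ such that $d\sigma=v^{-p'}\,dx$ and $d\omega=w^q\,dx$ are locally finite absolutely continuous measures on $\mathbb{R}^m\times\mathbb{R}^n$. Let $\mathcal{R}^{m,n}=\mathcal{D}^m\times\mathcal{D}^n$ be a partial grid of dyadic rectangles and let $K:\mathcal{R}^{m,n}\to[0,\infty)$. Let $\mathbb{N}_K(\sigma,\omega)\in[0,\infty]$ be the best constant in the inequality $$\sum_{R\in\mathcal{R}^{m,n}}K(R)\left(\int_R f\,d\sigma\right)\left(\int_R g\,d\omega\right)\le \mathbb{N}_K(\sigma,\omega)\,\|f\|_{L^p(\sigma)}\|g\|_{L^{q'}(\omega)},\qquad f,g\ge 0 .$$ If the $\theta$-bump product characteristic $$\mathbb{A}_{K,\theta}(\sigma,\omega)\equiv\sup_{R\in\mathcal{R}^{m,n}}K(R)\left[|R|^{\frac{1}{p'\theta'}}\left(\int_R v^{-p'\theta}\,dx\right)^{\frac{1}{p'\theta}}\right]\left[|R|^{\frac{1}{q\theta'}}\left(\int_R w^{q\theta}\,dx\right)^{\frac{1}{q\theta}}\right]=\sup_{R\in\mathcal{R}^{m,n}}K(R)\,|R|_{\omega,\theta}^{\frac1q}\,|R|_{\sigma,\theta}^{\frac1{p'}}$$ is finite, then $\mathbb{N}_K(\sigma,\omega)$ is finite, with a bound depending only on $p,q,\theta,m,n$ and $\mathbb{A}_{K,\theta}(\sigma,\omega)$, and not otherwise on the choice of partial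 grid $\mathcal{R}^{m,n}=\mathcal{D}^m\times\mathcal{D}^n$.
   Context: Primes denote conjugate exponents: $p'=p/(p-1)$, $q'=q/(q-1)$, $\theta'=\theta/(\theta-1)$. $dx$ is Lebesgue measure on $\mathbb{R}^m\times\mathbb{R}^n$ and $|R|$ is the Lebesgue measure of $R$. A dyadic grid $\mathcal{D}^N$ in $\mathbb{R}^N$ is a family of half-open cubes with sides parallel to the axes such that, for some $\lambda>0$, all side lengths are in $\{\lambda 2^k\}_{k\in\mathbb{Z}}$; for each $k\in\mathbb{Z}$ the cubes of side length $\lambda 2^k$ in the family tile $\mathbb{R}^N$; and any two cubes of the family are either disjoint or one is contained in the other. Given dyadic grids $\mathcal{D}^m$ in $\mathbb{R}^m$ and $\mathcal{D}^n$ in $\mathbb{R}^n$, the partial grid is $\mathcal{R}^{m,n}=\mathcal{D}^m\times\mathcal{D}^n=\{I\times J: I\in\mathcal{D}^m,\ J\in\mathcal{D}^n\}$. For $d\mu(x,y)=u(x,y)\,dx\,dy$ absolutely continuous and $R$ a rectangle in $\mathbb{R}^m\times\mathbb{R}^n$, the $\theta$-bump functional is $$|R|_{\mu,\theta}\equiv|R|^{\frac1{\theta'}}\left(\int_R u^\theta\right)^{\frac1\theta}\in[0,\infty].$$ The convention $0\cdot\infty=0$ is used. The functions $f,g$ are measurable. *)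

(* Defs.v *)
From HB Require Import structures.
From mathcomp Require Import all_boot all_order all_algebra.
From mathcomp Require Import all_classical all_reals all_analysis.
From mathcomp Require Import measurable_realfun.

Set Implicit Arguments.
Unset Strict Implicit.
Unset Printing Implicit Defensive.
Import Order.TTheory GRing.Theory Num.Theory.

Local Open Scope classical_set_scope.
Local Open Scope ring_scope.

(* R^N with its Borel sigma-algebra: the one generated by the coordinates. *)
Notation tupleR R N := (N.-tuple (measurableTypeR R)).

Section lebesgue_tuple.
Context {R : realType}.

Definition tcons N (x : measurableTypeR R * tupleR R N) : tupleR R N.+1 :=
  [tuple of x.1 :: x.2].

Lemma measurable_tcons N : measurable_fun setT (@tcons N).
Proof.
exact: (measurable_cons (@measurable_fst _ _ _ _) (@measurable_snd _ _ _ _)).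
Qed.

Section step.
Local Open Scope ereal_scope.
Variables (N : nat) (mu : {sigma_finite_measure set (tupleR R N) -> \bar R}).

Definition tcons_measure : set (tupleR R N.+1) -> \bar R :=
  pushforward (@lebesgue_measure R \x mu) (@tcons N).

Let tcons_measure0 : tcons_measure set0 = 0.
Proof. by rewrite /tcons_measure /pushforward preimage_set0 measure0. Qed.

Let tcons_measure_ge0 A : 0 <= tcons_measure A.
Proof. by rewrite /tcons_measure /pushforward; exact: measure_ge0. Qed.

Let tcons_measure_sigma_additive : semi_sigma_additive tcons_measure.
Proof.
move=> F mF tF mUF; rewrite /tcons_measure /pushforward preimage_bigcup.
apply: measure_semi_sigma_additive.
- by move=> n; rewrite -[X in measurable X]setTI; exact: measurable_tcons.
- apply/trivIsetP => /= i j _ _ ij; rewrite -preimage_setI.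
  by move/trivIsetP : tF => /(_ _ _ _ _ ij) ->//; rewrite preimage_set0.
- rewrite -preimage_bigcup -[X in measurable X]setTI.
  exact: measurable_tcons.
Qed.

HB.instance Definition _ := isMeasure.Build _ _ _ tcons_measure
  tcons_measure0 tcons_measure_ge0 tcons_measure_sigma_additive.

Let tcons_measure_sigma_finite : sigma_finite setT tcons_measure.
Proof.
have /sigma_finiteP[F [TF ndF Foo]] := sigma_finiteT (@lebesgue_measure R).
have /sigma_finiteP[G [TG ndG Goo]] := sigma_finiteT mu.
pose split (t : tupleR R N.+1) : measurableTypeR R * tupleR R N :=
  (tnth t ord0, [tuple of behead t]).
have msplit : measurable_fun setT split.
  apply/measurable_fun_pairP; split => /=.
  - exact: measurable_tnth.
  - exact: measurable_behead.
have tconsK : split \o @tcons N = id.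
  by apply/funext => -[x t]; congr pair; exact: val_inj.
exists (fun k => split @^-1` (F k `*` G k)).
  rewrite -preimage_bigcup (_ : \bigcup_k _ = setT) ?preimage_setT//.
  rewrite -setXTT TF TG predeqE => -[x y]; split.
    by move=> [n _ []/= ? ?]; split; exists n.
  move=> [/= [n _ Fnx] [k _ Gky]]; exists (maxn n k) => //; split.
  - by move: x Fnx; exact/subsetPset/ndF/leq_maxl.
  - by move: y Gky; exact/subsetPset/ndG/leq_maxr.
move=> k; have [mF Fk] := Foo k; have [mG Gk] := Goo k; split.
  by rewrite -[X in measurable X]setTI; apply: msplit => //; exact: measurableX.
rewrite /tcons_measure /pushforward -comp_preimage tconsK preimage_id.
by rewrite product_measure1E// lte_mul_pinfty// ge0_fin_numE.
Qed.

HB.instance Definition _ := Measure_isSigmaFinite.Build _ _ _ tcons_measure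
  tcons_measure_sigma_finite.

End step.

(* dx_1 ... dx_N, as an iterated product; R^0 is a point of mass 1. *)
Fixpoint lebesgue_tuple (N : nat) :
    {sigma_finite_measure set (tupleR R N) -> \bar R} :=
  match N with
  | 0 => [the {sigma_finite_measure set _ -> \bar R} of
           @dirac _ (tupleR R 0) [tuple] R]
  | N'.+1 => [the {sigma_finite_measure set _ -> \bar R} of
               tcons_measure (lebesgue_tuple N')]
  end.

End lebesgue_tuple.

Section lebesgue_prod.
Variables (R : realType) (m n : nat).

Definition borel_prod : {measure set (tupleR R m * tupleR R n) -> \bar R} :=
  [the {measure set _ -> \bar R} of
    (@lebesgue_tuple R m \x @lebesgue_tuple R n)%E].

(* R^m x R^n with the sigma-algebra of Lebesgue measurable sets (and not only
   the Borel ones); dx is the complete Lebesgue measure on it. *)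
Definition lebR := caratheodory_type (borel_prod^*)%mu.
HB.instance Definition _ := Measurable.on lebR.

Definition dx : {measure set lebR -> \bar R} :=
  [the {measure set _ -> \bar R} of
    @completed_measure_extension _ _ _ borel_prod].

(* A neighborhood of z contains an open sup-norm ball centered at z. *)
Definition locally_finite (mu : {measure set lebR -> \bar R}) :=
  forall z : lebR, exists2 e : R, 0 < e &
    (mu [set x : lebR | (forall i, `|tnth x.1 i - tnth z.1 i| < e)%R /\
                        (forall j, `|tnth x.2 j - tnth z.2 j| < e)%R] < +oo)%E.

End lebesgue_prod.
Arguments dx {R m n}.

Section dyadic.
Variable R : realType.

(* Half-open means closed on the left, open on the right. *)
Definition cube N (a : tupleR R N) (s : R) : set (tupleR R N) :=
  [set x | forall i, tnth a i <= tnth x i < tnth a i + s].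

Definition is_cube N (s : R) (Q : set (tupleR R N)) := exists a, Q = cube a s.

Definition dyadic_grid N (D : set (set (tupleR R N))) :=
  exists lambda : R, [/\ 0 < lambda,
    forall Q, D Q -> exists k : int, is_cube (lambda * 2 ^ k) Q,
    forall k : int, let Dk := [set Q | D Q /\ is_cube (lambda * 2 ^ k) Q] in
      \bigcup_(Q in Dk) Q = setT /\ trivIset Dk id &
    forall Q Q', D Q -> D Q' ->
      [\/ Q `&` Q' = set0, Q `<=` Q' | Q' `<=` Q]].

Definition partial_grid m n (Dm : set (set (tupleR R m)))
    (Dn : set (set (tupleR R n))) : set (set (lebR R m n)) :=
  [set Q | exists I J, [/\ Dm I, Dn J & Q = I `*` J]].

End dyadic.

Definition conj_exp (R : realType) (p : R) : R := p / (p - 1).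

Section characteristics.
Variables (R : realType) (m n : nat).
Local Notation X := (lebR R m n).
Variables (G : set (set X)) (K : set X -> R).
Local Open Scope ereal_scope.

Definition bilinear_ineq (p q : R) (sigma omega : {measure set X -> \bar R})
    (C : R) :=
  forall f g : X -> \bar R,
    measurable_fun setT f -> measurable_fun setT g ->
    (forall x, 0 <= f x) -> (forall x, 0 <= g x) ->
    \esum_(Q in G) ((K Q)%:E * \int[sigma]_(x in Q) f x *
                               \int[omega]_(x in Q) g x)
    <= C%:E * Lnorm sigma p%:E f * Lnorm omega (conj_exp q)%:E g.

(* The infimum of the empty set is +oo, so this is +oo when the inequality
   holds for no finite constant. *)
Definition best_constant (p q : R) (sigma omega : {measure set X -> \bar R}) :
    \bar R :=
  ereal_inf [set C%:E | C in [set C | (0 <= C)%R /\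
                                      bilinear_ineq p q sigma omega C]].

(* |Q|_{mu,theta} for d mu = u dx *)
Definition theta_bump (theta : R) (u : X -> \bar R) (Q : set X) : \bar R :=
  dx Q `^ (conj_exp theta)^-1 *
  (\int[dx]_(x in Q) (u x `^ theta)) `^ theta^-1.

(* Negative powers v^{-r} are written (v^-1)^r, with the inverse on [0,+oo]
   for which 0^-1 = +oo and +oo^-1 = 0: the library's power function has
   0 `^ (- r) = 0 and +oo `^ (- r) = +oo instead, for r > 0. *)
Definition bump_characteristic (p q theta : R) (v w : X -> \bar R) : \bar R :=
  let p' := conj_exp p in let theta' := conj_exp theta in
  ereal_sup [set (K Q)%:E *
      (dx Q `^ (p' * theta')^-1 *
        (\int[dx]_(x in Q) (inve (v x) `^ (p' * theta))) `^ (p' * theta)^-1) *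
      (dx Q `^ (q * theta')^-1 *
        (\int[dx]_(x in Q) (w x `^ (q * theta))) `^ (q * theta)^-1)
    | Q in G].

End characteristics.

(* Main.v *)
(* Put F = f v^(-p'/p) and H = g w^(q/q'), so that the norms of f and g become
   unweighted norms of F and H. Hoelder's inequality on R with exponents a and
   p' theta, where a < p is conjugate to p' theta, gives
     int_R f dsigma <= |R|_(sigma,theta)^(1/p') x_R,
     x_R = |R|^(1/p - 1/a) (int_R F^a)^(1/a),
   and likewise y_R for g, so that the form is at most A sum_R x_R y_R. For
   p < r < q it then suffices to embed L^p into l^r by F |-> (x_R) and L^q' into
   l^r' by H |-> (y_R). Replacing F by Phi = F^a, this is the inequality
     sum_R (|R|^(1/S-1) int_R Phi)^rho <= C (int Phi^S)^(rho/S),  1 < S < rho.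
   For cubes and int Phi^S = 1, split Phi on Q at the height |Q|^(-1/S), using
   Jensen below and Chebyshev above; at every point the resulting sum over cubes
   is dominated by two geometric series with total C Phi^S. For rectangles,
   iterate: apply the inequality in y to Phi(x, .) for each x, pull the l^rho norm
   inside int_I dx by Minkowski, and apply it in x to the norm of Phi(x, .) in
   L^S(dy). *)
Require Import Defs.
From HB Require Import structures.
From mathcomp Require Import all_boot all_order all_algebra.
From mathcomp Require Import all_classical all_reals all_analysis.
From mathcomp Require Import measurable_realfun.
From mathcomp Require Import ring lra.
Set Implicit Arguments.
Unset Strict Implicit.
Unset Printing Implicit Defensive.
Import Order.TTheory GRing.Theory Num.Theory.
Local Open Scope classical_set_scope.
Local Open Scope ring_scope.

(** * Young's inequality and lacunary sums *)

Lemma gee0_ler_poweR (R : realType) (r : R) (x y : \bar R) :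
  0 <= r -> (0 <= x)%E -> (x <= y)%E -> (x `^ r <= y `^ r)%E.
Proof.
move=> r0 x0 xy; by apply: gt0_ler_poweR => //; rewrite in_itv/= leey andbT//
  (le_trans x0).
Qed.

Lemma poweRK (R : realType) (r : R) (x : \bar R) :
  0 < r -> (0 <= x)%E -> ((x `^ r) `^ r^-1 = x)%E.
Proof. by move=> r0 x0; rewrite -poweRrM divff ?gt_eqF// poweRe1. Qed.

Lemma poweRVK (R : realType) (r : R) (x : \bar R) :
  0 < r -> (0 <= x)%E -> ((x `^ r^-1) `^ r = x)%E.
Proof. by move=> r0 x0; rewrite -poweRrM mulVf ?gt_eqF// poweRe1. Qed.

(** Young's inequality for [t * u] and [v / t], with the factors 1/a and 1/b dropped since they are
    at most 1. The free [t] lets the bound be integrated or summed first and optimised afterwards,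
    so that Hoelder's inequality follows without normalising. *)
Lemma young_mule (R : realType) (a b t : R) (u v : \bar R) :
  0 < a -> 0 < b -> a^-1 + b^-1 = 1 -> 0 < t -> (0 <= u)%E -> (0 <= v)%E ->
  (u * v <= (t `^ a)%:E * u `^ a + (t `^ (- b))%:E * v `^ b)%E.
Proof.
move=> a0 b0 ab t0 u0 v0.
have ta : 0 < t `^ a by exact: powR_gt0.
have tb : 0 < t `^ (- b) by exact: powR_gt0.
case: u u0 => [u u0|_|//]; last first.
  by rewrite poweRyr ?gt_eqF// gt0_muley ?lte_fin// addye ?leey// gt_eqF//
    (@lt_le_trans _ _ 0%E)// mule_ge0// ?lee_fin ?poweR_ge0// ltW.
case: v v0 => [v v0|_|//]; last first.
  by rewrite [in leRHS]poweRyr ?gt_eqF// [in leRHS]gt0_muley ?lte_fin// addey ?leey//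
    gt_eqF// (@lt_le_trans _ _ 0%E)// mule_ge0// ?lee_fin ?poweR_ge0// ltW.
rewrite !poweR_EFin -!EFinM -EFinD lee_fin; rewrite !lee_fin in u0 v0.
have tu0 : 0 <= t * u by rewrite mulr_ge0 // ltW.
have vt0 : 0 <= v / t by rewrite divr_ge0 // ltW.
have := conjugate_powR tu0 vt0 a0 b0 ab.
have -> : t * u * (v / t) = u * v by field; rewrite gt_eqF.
move=> /le_trans; apply.
have t0' := ltW t0; rewrite powRM// powRM ?invr_ge0//.
rewrite -(powR_inv1 t0')  -powRrM mulN1r [v `^ b * _]mulrC.
have a1 : a^-1 <= 1 by rewrite -ab lerDl invr_ge0 ltW.
have b1 : b^-1 <= 1 by rewrite -ab lerDr invr_ge0 ltW.
by rewrite lerD// ler_piMr// mulr_ge0 ?powR_ge0.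
Qed.

(* At the optimal [t] both terms of the bound are equal, hence the factor 2. *)
Lemma le_young_opt (R : realType) (a b : R) (X Y Z : \bar R) :
  0 < a -> 0 < b -> a^-1 + b^-1 = 1 -> (0 <= X)%E -> (0 <= Y)%E ->
  (X = 0 -> Z <= 0)%E -> (Y = 0 -> Z <= 0)%E ->
  (forall t : R, 0 < t -> (Z <= (t `^ a)%:E * X + (t `^ (- b))%:E * Y)%E) ->
  (Z <= 2%:E * (X `^ a^-1 * Y `^ b^-1))%E.
Proof.
move=> a0 b0 ab X0 Y0 ZX ZY H.
have R0 : (0 <= 2%:E * (X `^ a^-1 * Y `^ b^-1))%E.
  by rewrite !mule_ge0 ?poweR_ge0// lee_fin.
(* When X = 0 and Y = +oo the bounds in [H] are all +oo while the claim is Z <= 0; [ZX] and [ZY]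
   settle these degenerate cases. *)
have [/ZX /le_trans ->//|Xn0] := eqVneq X 0%E.
have [/ZY /le_trans ->//|Yn0] := eqVneq Y 0%E.
have Xp : (0 < X)%E by rewrite lt0e Xn0.
have Yp : (0 < Y)%E by rewrite lt0e Yn0.
have [Xy|Xy] := eqVneq X +oo%E.
  rewrite Xy poweRyr ?invr_eq0 ?gt_eqF// gt0_mulye ?poweR_gt0//.
  by rewrite gt0_muley ?lte_fin// leey.
have [Yy|Yy] := eqVneq Y +oo%E.
  rewrite Yy poweRyr ?invr_eq0 ?gt_eqF// gt0_muley ?poweR_gt0//.
  by rewrite gt0_muley ?lte_fin// leey.
case: X {X0 ZX Xn0 R0} Xp Xy H => [x x0 _ H|//|//].
case: Y {Y0 ZY Yn0} Yp Yy H => [y y0 _ H|//|//].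
rewrite !lte_fin in x0 y0.
(* The solution of t^a x = t^(-b) y: since a + b = ab, it is t = (y/x)^(1/(ab)). *)
pose t := x `^ (- (a^-1 * b^-1)) * y `^ (a^-1 * b^-1).
have t0 : 0 < t by rewrite mulr_gt0// powR_gt0.
apply: le_trans (H t t0) _.
have aE : a^-1 = 1 - b^-1 by rewrite -ab addrK.
have bE : b^-1 = 1 - a^-1 by rewrite -ab addrC addKr.
have e1 : t `^ a * x = x `^ a^-1 * y `^ b^-1.
  rewrite powRM ?powR_ge0// -!powRrM mulrAC -[X in _ * X * _]powRr1 ?ltW//.
  rewrite -powRD ?(gt_eqF x0) ?implybT//.
  by congr (_ `^ _ * _ `^ _); [rewrite [RHS]aE|]; field; rewrite !gt_eqF.
have e2 : t `^ (- b) * y = x `^ a^-1 * y `^ b^-1.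
  rewrite powRM ?powR_ge0// -!powRrM -mulrA -[X in _ * (_ * X)]powRr1 ?ltW//.
  rewrite -powRD ?(gt_eqF y0) ?implybT//.
  by congr (_ `^ _ * _ `^ _); [|rewrite [RHS]bE]; field; rewrite !gt_eqF.
rewrite !poweR_EFin -!EFinM e1 e2 -EFinD lee_fin.
by rewrite mulr2n mulrDl mul1r.
Qed.

Definition geo_const (R : realType) (k : R) : R := (1 - 2 `^ (- k))^-1.

Lemma powR2N_lt1 (R : realType) (k : R) : 0 < k -> 2 `^ (- k) < 1.
Proof.
move=> k0; rewrite powRN invf_lt1 ?powR_gt0//.
by rewrite -[ltLHS](powRr0 (2:R)) /powR !(gt_eqF (_ : 0 < (2 : R)))//
  ltr_expR ltr_pM2r ?ln_gt0// ltr1n.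
Qed.

Lemma geo_const_gt0 (R : realType) (k : R) : 0 < k -> 0 < geo_const k.
Proof. by move=> k0; rewrite invr_gt0 subr_gt0 powR2N_lt1. Qed.

(** Split off the largest value: by separation all others are at most half of it, so the sum is
    dominated by a geometric series of ratio 2^(-k). The bound [M] varies in the induction. *)
Lemma sum_powR_lacunary (R : realType) (T : eqType) (v : T -> R) (k M : R)
    (s : seq T) : 0 < k -> uniq s ->
  (forall i, i \in s -> 0 < v i <= M) ->
  (forall i j, i \in s -> j \in s -> i != j -> 2 * v i <= v j \/ 2 * v j <= v i) ->
  \sum_(i <- s) v i `^ k <= geo_const k * M `^ k.
Proof.
move=> k0; move: {2}(size s) (leqnn (size s)) => n.
elim: n s M => [|n ih] s M.
  case: s => // _ _ _ _; rewrite big_nil mulr_ge0 ?powR_ge0//.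
  exact/ltW/geo_const_gt0.
move=> sn us vM sep.
have [->|sN0] := eqVneq s [::].
  by rewrite big_nil mulr_ge0 ?powR_ge0//; exact/ltW/geo_const_gt0.
have [i si imax] : exists2 i, i \in s & forall j, j \in s -> v j <= v i.
  case: s sN0 {sn us vM sep ih} => // x s _.
  elim: s x => [|y s ih] x.
    by exists x; rewrite ?inE// => j; rewrite inE => /eqP ->.
  have [i si im] := ih y.
  have [xi|ix] := leP (v x) (v i).
    exists i; first by rewrite inE si orbT.
    by move=> j; rewrite inE => /predU1P[->//|/im].
  exists x; rewrite ?mem_head// => j; rewrite inE => /predU1P[->//|/im ji].
  exact: le_trans ji (ltW ix).
have /andP[vi0 viM] := vM i si.
rewrite (perm_big _ (perm_to_rem si))/= big_cons.
have memr j : j \in rem i s -> j \in s /\ j != i.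
  by rewrite mem_rem_uniq// inE => /andP[].
have := ih (rem i s) (v i / 2).
rewrite size_rem// -ltnS (leq_trans _ sn) ?prednK ?leqnn//; last by case: (s) sN0.
rewrite rem_uniq// => /(_ isT isT) h.
have {h} : \sum_(j <- rem i s) v j `^ k <= geo_const k * (v i / 2) `^ k.
  apply: h => [j /memr[sj ji]|j l /memr[sj _] /memr[sl _]]; last exact: sep.
  have /andP[vj0 _] := vM j sj; rewrite vj0/=.
  case: (sep j i sj si ji) => h; first by rewrite ler_pdivlMr// mulrC.
  by have := imax j sj => h2; move: h vj0 vi0 h2 => ? ? ? ?; lra.
move=> h; rewrite powRM ?invr_ge0 ?(ltW vi0)// -powR_inv1// -powRrM mulN1r in h.
apply: (@le_trans _ _ (geo_const k * v i `^ k)); last first.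
  rewrite ler_pM2l ?geo_const_gt0//.
  by apply: ge0_ler_powR => //; rewrite ?nnegrE ltW// (lt_le_trans vi0).
apply: le_trans (lerD (lexx _) h) _.
(* The constant satisfies c = 1 + c 2^(-k), so it absorbs the term split off. *)
have g1 : geo_const k * 2 `^ (- k) = geo_const k - 1.
  have := powR2N_lt1 k0; rewrite /geo_const -subr_gt0 => h2.
  by field; rewrite gt_eqF.
by rewrite mulrCA g1; lra.
Qed.

(** * Splitting at the critical height *)

Section splitting.
Variable R : realType.
Implicit Types (S rho d : R) (t : \bar R).
Local Open Scope ereal_scope.

(* The two branches are the densities of the Jensen and Chebyshev bounds for
   [(d^(1/S-1) int_Q f)^rho] on a set [Q] of measure [d], see
   [integral_split_bump]. *)
Definition split_bump S rho d t : \bar R :=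
  if t <= (d `^ (- S^-1))%:E then (d `^ (rho / S - 1))%:E * t `^ rho
  else (d `^ (S^-1 - 1))%:E * t.

(** One geometric series per branch of [split_bump]: the first for measures d <= t^(-S), the second
    for larger ones. *)
Definition split_const S rho : R := geo_const (rho / S - 1) + geo_const (1 - S^-1).

Lemma split_bump_ge0 S rho d t : 0 <= t -> 0 <= split_bump S rho d t.
Proof.
by move=> t0; rewrite /split_bump; case: ifP => _;
  rewrite mule_ge0 ?poweR_ge0// lee_fin powR_ge0.
Qed.

(** With v_i = d_i t^S, the summand is t^S v_i^(rho/S - 1) if v_i <= 1 and t^S (1/v_i)^(1 - 1/S)
    otherwise. Both are positive powers of lacunary quantities bounded by 1; S < rho and 1 < S make
    the exponents positive. *)
Lemma sum_split_bump S rho (T : eqType) (d : T -> R) (s : seq T) t :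
  (1 < S)%R -> (S < rho)%R -> 0 <= t -> uniq s ->
  (forall i, i \in s -> (0 < d i)%R) ->
  (forall i j, i \in s -> j \in s -> i != j ->
     (2 * d i <= d j)%R \/ (2 * d j <= d i)%R) ->
  \sum_(i <- s) split_bump S rho (d i) t <= (split_const S rho)%:E * t `^ S.
Proof.
move=> S1 Srho t0 us d0 sep.
have S0 : (0 < S)%R by exact: lt_trans S1.
have k1 : (0 < rho / S - 1)%R by rewrite subr_gt0 ltr_pdivlMr// mul1r.
have k2 : (0 < 1 - S^-1)%R by rewrite subr_gt0 invf_lt1.
have c0 : (0 < split_const S rho)%R by rewrite addr_gt0// geo_const_gt0.
case: t t0 => [t t0|_|//]; last first.
  by rewrite poweRyr ?gt_eqF// gt0_muley ?lte_fin// leey.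
rewrite lee_fin le_eqVlt in t0; case/predU1P: t0 => [<-|t0].
  rewrite big1 ?mule_ge0 ?poweR_ge0// ?lee_fin ?ltW// => i _.
  by rewrite /split_bump lee_fin powR_ge0 poweR0r ?gt_eqF ?mule0// (lt_trans S0).
have tS0 : (0 < t `^ S)%R by exact: powR_gt0.
pose v i := (d i * t `^ S)%R.
have v0 i : i \in s -> (0 < v i)%R by move=> /d0 di; rewrite mulr_gt0.
pose P i := (v i <= 1)%R.
pose w i := if P i then (v i `^ (rho / S - 1))%R else ((v i)^-1 `^ (1 - S^-1))%R.
have bE i : i \in s -> split_bump S rho (d i) t%:E = (t `^ S * w i)%:E.
  move=> /[dup] si /d0 di; rewrite /split_bump /w lee_fin.
  have -> : (t <= d i `^ (- S^-1))%R = P i.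
    have e : ((d i `^ (- S^-1)) `^ S = (d i)^-1)%R.
      by rewrite -powRrM mulNr mulVf ?gt_eqF// powR_inv1// ltW.
    rewrite /P /v mulrC -ler_pdivlMr// mul1r -e.
    apply/idP/idP => h.
      by apply: ge0_ler_powR => //; rewrite ?nnegrE ?powR_ge0 ?ltW.
    rewrite leNgt; apply/negP => h2.
    have := @gt0_ltr_powR _ S S0 (d i `^ (- S^-1))%R t.
    by rewrite !nnegrE powR_ge0 (ltW t0) => /(_ isT isT h2); rewrite ltNge h.
  case: ifP => _.
    rewrite poweR_EFin -EFinM; congr EFin.
    rewrite /v powRM ?ltW// mulrCA -powRrM -powRD; last by rewrite (gt_eqF t0) implybT.
    by congr (_ * _ `^ _)%R; field; rewrite gt_eqF.
  rewrite -EFinM; congr EFin.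
  rewrite -(powR_inv1 (ltW (v0 _ si))) -powRrM /v powRM ?ltW// mulrCA -powRrM -powRD;
    last by rewrite (gt_eqF t0) implybT.
  rewrite (_ : S + _ = 1)%R ?powRr1 ?ltW//; last by field; rewrite gt_eqF.
  by congr (_ `^ _ * _)%R; field; rewrite gt_eqF.
have one k : (1 = 1 `^ k :> R)%R by rewrite powR1.
rewrite big_seq (eq_bigr _ bE) -big_seq sumEFin lee_fin -mulr_sumr.
rewrite mulrC ler_pM2r// (bigID P)/= lerD//.
- rewrite -big_filter big_seq; under eq_bigr.
    by move=> i; rewrite mem_filter => /andP[Pi _]; rewrite /w Pi; over.
  rewrite -big_seq -[leRHS]mulr1 [X in (_ <= _ * X)%R](one (rho / S - 1)%R).
  apply: sum_powR_lacunary; rewrite ?filter_uniq//.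
    by move=> i; rewrite mem_filter => /andP[Pi /v0 ->].
  move=> i j; rewrite !mem_filter => /andP[_ si] /andP[_ sj] ij.
  by rewrite /v !mulrA !ler_pM2r//; exact: sep.
- rewrite -big_filter big_seq; under eq_bigr.
    by move=> i; rewrite mem_filter => /andP[/negbTE Pi _]; rewrite /w Pi; over.
  rewrite -big_seq -[leRHS]mulr1 [X in (_ <= _ * X)%R](one (1 - S^-1)%R).
  apply: (@sum_powR_lacunary _ _ (fun i => (v i)^-1)%R); rewrite ?filter_uniq//.
    move=> i; rewrite mem_filter => /andP[Pi /v0 vi].
    by rewrite invr_gt0 vi/= invf_le1// ltW// ltNge.
  move=> i j; rewrite !mem_filter => /andP[_ si] /andP[_ sj] ij.
  have E a b : a \in s -> b \in s ->
      (2 * ((v a)^-1) <= (v b)^-1)%R = (2 * d b <= d a)%R.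
    move=> /v0 a0 /v0 b0.
    by rewrite ler_pdivrMr// mulrC ler_pdivlMr// /v !mulrA ler_pM2r// mulrC.
  by rewrite !E//; apply: sep; rewrite // eq_sym.
Qed.
End splitting.

(** * Integral inequalities *)

Section integral_inequalities.
Context d (T : measurableType d) (R : realType).
Variable mu : {measure set T -> \bar R}.
Local Open Scope ereal_scope.
Implicit Types (D : set T) (f g : T -> \bar R) (a b : R).

Lemma measurable_fun_poweR D f a :
  measurable_fun D f -> measurable_fun D (fun x => f x `^ a).
Proof. exact: (measurableT_comp (measurable_poweR a)). Qed.

(** Here [f] vanishes almost everywhere, and 0 * oo = 0 makes the product vanish even where [g] is
    infinite. This is the degenerate case of Hoelder's inequality. *)
Lemma integral_poweR_eq0 D f g a : measurable D ->
  measurable_fun D f -> measurable_fun D g ->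
  (forall x, 0 <= f x) -> (forall x, 0 <= g x) ->
  \int[mu]_(x in D) (f x `^ a) = 0 -> \int[mu]_(x in D) (f x * g x) = 0.
Proof.
move=> mD mf mg f0 g0 If.
have : \int[mu]_(x in D) `|f x `^ a| = 0.
  by rewrite -[RHS]If; apply: eq_integral => x _; rewrite gee0_abs// poweR_ge0.
move=> /ae_eq_integral_abs -/(_ mD (measurable_fun_poweR a mf)) fa.
rewrite (ae_eq_integral (cst 0))// ?integral0//; first exact: emeasurable_funM.
by apply: filterS fa => x /= h /h /poweR_eq0_eq0 ->//; rewrite mul0e.
Qed.

(** Integrate [young_mule] for every [t], then optimise by [le_young_opt]. *)
Lemma ge0_hoelder D f g a b : measurable D ->
  measurable_fun D f -> measurable_fun D g ->
  (forall x, 0 <= f x) -> (forall x, 0 <= g x) ->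
  (0 < a)%R -> (0 < b)%R -> (a^-1 + b^-1 = 1)%R ->
  \int[mu]_(x in D) (f x * g x) <=
    2%:E * ((\int[mu]_(x in D) (f x `^ a)) `^ a^-1 *
            (\int[mu]_(x in D) (g x `^ b)) `^ b^-1).
Proof.
move=> mD mf mg f0 g0 a0 b0 ab.
have mfa := measurable_fun_poweR a mf; have mgb := measurable_fun_poweR b mg.
apply: le_young_opt => //.
- by apply: integral_ge0 => x _; exact: poweR_ge0.
- by apply: integral_ge0 => x _; exact: poweR_ge0.
- by move=> h; rewrite (integral_poweR_eq0 _ _ _ _ _ h).
- move=> h; under eq_integral do rewrite muleC.
  by rewrite (integral_poweR_eq0 _ _ _ _ _ h).
- move=> t t0.
  have p0 (c r s : R) u : 0 <= (c `^ r)%R%:E * (u `^ s).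
    by rewrite mule_ge0 ?poweR_ge0// lee_fin powR_ge0.
  rewrite -!ge0_integralZl_EFin ?powR_ge0//; try by move=> x _; exact: poweR_ge0.
  rewrite -ge0_integralD//.
  + apply: ge0_le_integral => //.
    * by move=> x _; rewrite mule_ge0.
    * exact: emeasurable_funM.
    * by apply: emeasurable_funD; apply: measurable_funeM.
    * by move=> x _; exact: young_mule.
  + exact: measurable_funeM.
  + exact: measurable_funeM.
Qed.

Lemma poweR_leD (r : R) (x y : \bar R) : (0 <= r)%R -> 0 <= x -> 0 <= y ->
  (x + y) `^ r <= (2 `^ r)%:E * (x `^ r + y `^ r).
Proof.
move=> r0; have t0 : (0 <= 2 `^ r :> R)%R by exact: powR_ge0.
have H (u v : \bar R) : 0 <= u -> u <= v -> (u + v) `^ r <= (2 `^ r)%:E * (u `^ r + v `^ r).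
  move=> u0 uv; have v0 := le_trans u0 uv.
  apply: (@le_trans _ _ ((2%:E * v) `^ r)).
    by apply: gee0_ler_poweR => //; [exact: adde_ge0|rewrite mule_natl mule2n leeD2r].
  by rewrite poweRM ?lee_fin// poweR_EFin lee_wpmul2l ?lee_fin// leeDr ?poweR_ge0.
move=> x0 y0; have [xy|yx] := leP x y; first exact: H.
by rewrite addeC [in leRHS]addeC; apply: H => //; exact: ltW.
Qed.

Lemma measurable_split_bump (S rho del : R) f : measurable_fun setT f ->
  measurable_fun setT (fun x => split_bump S rho del (f x)).
Proof.
move=> mf; apply: measurable_fun_ifT.
- exact: measurable_fun_lee.
- by apply: measurable_funeM; exact: measurable_fun_poweR.
- exact: measurable_funeM.
Qed.

(** Split [D] at the height lam = del^(-1/S). Below it, Hoelder against the constant 1 is Jensen's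
    bound. Above it, lam^(S-1) f <= f^S, which is Chebyshev's bound and where the normalisation of
    the integral of f^S enters. *)
Lemma integral_split_bump D f (del S rho : R) :
  measurable D -> mu D = del%:E -> (0 < del)%R -> (1 < S)%R -> (S < rho)%R ->
  measurable_fun setT f -> (forall x, 0 <= f x) ->
  \int[mu]_x (f x `^ S) <= 1 ->
  ((del `^ (S^-1 - 1))%:E * \int[mu]_(x in D) f x) `^ rho <=
    (4 `^ rho)%:E * \int[mu]_(x in D) split_bump S rho del (f x).
Proof.
move=> mD muD d0 S1 Srho mf f0 If.
have S0 : (0 < S)%R by exact: lt_trans S1.
have rho0 : (0 < rho)%R by exact: lt_trans Srho.
have rho1 : (1 < rho)%R by exact: lt_trans Srho.
pose lam := (del `^ (- S^-1))%R.
have lam0 : (0 < lam)%R by exact: powR_gt0.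
pose L := [set x | f x <= lam%:E].
have mL : measurable L.
  by rewrite -[L]setTI; apply: emeasurable_fun_infty_c.
pose A := D `&` L; pose B := D `\` L.
have mA : measurable A by exact: measurableI.
have mB : measurable B by exact: measurableD.
have DAB : D = A `|` B by rewrite setUIDK.
have dAB : [disjoint A & B] by rewrite disj_set2E setIDA [A `&` D]setIC /A setIA setIid -setIDA setDv setI0.
pose alpha := (rho / S - 1)%R.
have bA x : A x -> split_bump S rho del (f x) = (del `^ alpha)%:E * f x `^ rho.
  by move=> [_ Lx]; rewrite /split_bump ifT.
have bB x : B x -> split_bump S rho del (f x) = (del `^ (S^-1 - 1))%:E * f x.
  by move=> [_ Lx]; rewrite /split_bump ifF//; apply/negP.
have mfA : measurable_fun A f by exact: measurable_funTS.
have mfB : measurable_fun B f by exact: measurable_funTS.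
have mb : measurable_fun D (fun x => split_bump S rho del (f x)).
  exact/measurable_funTS/measurable_split_bump.
have c0 (c r : R) : 0 <= (c `^ r)%:E by rewrite lee_fin powR_ge0.
have IA0 : 0 <= \int[mu]_(x in A) f x by exact: integral_ge0.
have IB0 : 0 <= \int[mu]_(x in B) f x by exact: integral_ge0.
rewrite [in leLHS]DAB [in leRHS]DAB !ge0_integral_setU//; last 3 first.
- by rewrite -[X in measurable_fun X]DAB.
- by move=> x _; exact: split_bump_ge0.
- exact: measurable_funTS.
rewrite ge0_muleDr//.
apply: le_trans (poweR_leD (ltW rho0) (mule_ge0 (c0 _ _) IA0) (mule_ge0 (c0 _ _) IB0)) _.
(* One factor 2^rho comes from the power of a sum, the other from the constant 2 of
   [ge0_hoelder]. *)
have -> : (4 `^ rho)%R = (2 `^ rho * 2 `^ rho :> R)%R.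
  by rewrite -powRM//; congr (_ `^ _)%R; rewrite -natrM.
rewrite EFinM -muleA lee_wpmul2l// [leRHS]ge0_muleDr//; last 2 first.
- by apply: integral_ge0 => x _; exact: split_bump_ge0.
- by apply: integral_ge0 => x _; exact: split_bump_ge0.
apply: leeD.
- rewrite [X in _ <= _ * X](eq_integral (fun x => (del `^ alpha)%:E * f x `^ rho));
  last first.
    by move=> x /set_mem /bA.
  rewrite ge0_integralZl_EFin//; [|by move=> x _;
    exact: poweR_ge0|exact: measurable_fun_poweR|exact: powR_ge0].
  set b := (1 - rho^-1)^-1%R.
  have rV : (rho^-1 < 1)%R by rewrite invf_lt1.
  have b0 : (0 < b)%R by rewrite invr_gt0 subr_gt0.
  have rb : (rho^-1 + b^-1 = 1)%R by rewrite invrK; ring.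
  have := @ge0_hoelder A f (cst 1) rho b mA mfA _ f0 (fun=> lee01) rho0 b0 rb.
  move=> /(_ (measurable_cst _)).
  have -> : \int[mu]_(x in A) (cst 1 x `^ b) = mu A.
    rewrite (eq_integral (cst 1)) => [|x _]; last exact: poweR1r.
    by rewrite (integral_cst _ mA 1) mul1e.
  under eq_integral do rewrite /= mule1.
  move=> H.
  have {}H : \int[mu]_(x in A) f x <=
      2%:E * ((\int[mu]_(x in A) (f x `^ rho)) `^ rho^-1 * (del `^ b^-1)%:E).
    apply: le_trans H _; rewrite lee_wpmul2l ?lee_fin// lee_wpmul2l ?poweR_ge0//.
    rewrite -poweR_EFin -muD; apply: gee0_ler_poweR => //; first by rewrite invr_ge0 ltW.
    by apply: le_measure; rewrite ?inE//; exact: subIsetl.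
  apply: (@le_trans _ _ (((del `^ (S^-1 - 1))%:E * (2%:E * ((\int[mu]_(x in A) (f x `^ rho)) `^ rho^-1 * (del `^ b^-1)%:E))) `^ rho)).
    apply: gee0_ler_poweR; [exact: ltW|exact: mule_ge0|exact: lee_wpmul2l].
  have J0 : 0 <= \int[mu]_(x in A) (f x `^ rho) by apply: integral_ge0 => x _;
    exact: poweR_ge0.
  rewrite !poweRM ?mule_ge0 ?poweR_ge0 ?lee_fin ?powR_ge0//.
  rewrite poweRVK// !poweR_EFin muleCA lee_wpmul2l// muleCA [leRHS]muleC lee_wpmul2l//.
  (* The powers of [del] match: (1/S - 1) rho + (1 - 1/rho) rho = rho/S - 1. *)
  rewrite -EFinM lee_fin -!powRrM -powRD ?(gt_eqF d0) ?implybT//.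
  by rewrite invrK (_ : _ + _ = alpha)%R// /alpha; field; rewrite !gt_eqF.
- rewrite [X in _ <= _ * X](eq_integral (fun x => (del `^ (S^-1 - 1))%:E * f x));
  last first.
    by move=> x /set_mem /bB.
  rewrite ge0_integralZl_EFin ?powR_ge0//.
  set E := _ * _.
  have E0 : 0 <= E by rewrite mule_ge0.
  have E1 : E <= 1.
    apply: le_trans If.
    apply: (@le_trans _ _ (\int[mu]_(x in B) (f x `^ S))); last first.
      apply: ge0_subset_integral => //; first exact: measurable_fun_poweR.
      by move=> x _; exact: poweR_ge0.
    rewrite /E -ge0_integralZl_EFin ?powR_ge0//.
    apply: ge0_le_integral => //.
    + by move=> x _; rewrite mule_ge0.
    + exact: measurable_funeM.
    + exact: measurable_fun_poweR.
    (* On [B] one has lam < f(x), and del^(1/S - 1) = lam^(S - 1). *)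
    + move=> x [_ /negP]; rewrite -ltNge => fx.
      rewrite [leRHS](_ : _ = f x `^ (S - 1) * f x); last first.
        rewrite -[X in _ * X]poweRe1// -poweRD ?subrK//.
        by rewrite add_neq0_poweRD_def// subrK gt_eqF.
      rewrite lee_wpmul2r//.
      have -> : (del `^ (S^-1 - 1))%:E = lam%:E `^ (S - 1).
        by rewrite poweR_EFin /lam -powRrM; congr (_ `^ _)%R%:E; field; rewrite gt_eqF.
      by apply: gee0_ler_poweR; rewrite ?subr_ge0 ?lee_fin; exact: ltW.
  (* As E <= 1 and rho > 1, the power does not increase [E]. *)
  have Er : E `^ rho <= E.
    have Ef : E \is a fin_num by rewrite ge0_fin_numE// (le_lt_trans E1) ?ltry.
    move: E0 E1; rewrite -(fineK Ef) poweR_EFin !lee_fin => E0 E1.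
    rewrite le_eqVlt in E0; case/predU1P: E0 => [<-|E0]; first by rewrite powR0// gt_eqF.
    by apply: ge1r_powR; rewrite ?E0// ltW.
  apply: le_trans Er _.
  rewrite -[leLHS]mul1e lee_wpmul2r// lee_fin.
  by rewrite -[leLHS](powRr0 2); apply: ler_powR; [rewrite ler1n|exact: ltW].
Qed.

End integral_inequalities.

(** * The embedding for cubes *)

Section esum_extra.
Variables (R : realType) (T : choiceType).
Local Open Scope ereal_scope.
Implicit Types (D : set T) (a : T -> \bar R).

(** Together with [seq_le_esum], this reduces unordered sums to duplicate-free lists, for which
    lists can be filtered and sums exchanged with integrals. *)
Lemma esum_le_seq D a (M : \bar R) :
  (forall s : seq T, uniq s -> (forall x, x \in s -> D x) ->
    \sum_(x <- s) a x <= M) -> \esum_(x in D) a x <= M.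
Proof.
move=> H; apply: ge_ereal_sup => _ [X [fX XD] <-].
rewrite fsbig_finite//; apply: H => [|x]; first exact: finmap.fset_uniq.
by rewrite in_fset_set// => /set_mem /XD.
Qed.

Lemma seq_le_esum D a (s : seq T) : (forall x, D x -> 0 <= a x) ->
  uniq s -> (forall x, x \in s -> D x) ->
  \sum_(x <- s) a x <= \esum_(x in D) a x.
Proof.
move=> a0 us sD; apply: esum_ge; exists [set` s] => //.
by rewrite -fsbig_seq.
Qed.

Lemma esum_eq0 D a : (forall x, D x -> 0 <= a x) ->
  \esum_(x in D) a x = 0 -> forall x, D x -> a x = 0.
Proof.
move=> a0 H x Dx; apply/eqP; rewrite eq_le a0// andbT -H.
have := @seq_le_esum D a [:: x] a0 isT.
by rewrite big_seq1; apply => y; rewrite inE => /eqP ->.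
Qed.

Lemma esumZl_le D a (c : \bar R) : 0 <= c -> (forall x, D x -> 0 <= a x) ->
  \esum_(x in D) (c * a x) <= c * \esum_(x in D) a x.
Proof.
move=> c0 a0; apply: esum_le_seq => s us sD.
rewrite big_seq -ge0_sume_distrr; last by move=> i /sD /a0.
by rewrite -big_seq lee_wpmul2l// seq_le_esum.
Qed.

(** Same scheme as [ge0_hoelder]: sum [young_mule] over [D], then optimise in [t]. *)
Lemma esum_hoelder D (a b : T -> \bar R) (r s : R) :
  (forall x, D x -> 0 <= a x) -> (forall x, D x -> 0 <= b x) ->
  (0 < r)%R -> (0 < s)%R -> (r^-1 + s^-1 = 1)%R ->
  \esum_(x in D) (a x * b x) <=
    2%:E * ((\esum_(x in D) (a x `^ r)) `^ r^-1 *
            (\esum_(x in D) (b x `^ s)) `^ s^-1).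
Proof.
move=> a0 b0 r0 s0 rs.
have p0 (c : T -> \bar R) u x : D x -> 0 <= c x `^ u by move=> _; exact: poweR_ge0.
apply: le_young_opt => //; try exact/esum_ge0/p0.
- move=> /(esum_eq0 (p0 a r)) h; rewrite esum1// => x Dx.
  by rewrite (@poweR_eq0_eq0 _ (a x) r) ?mul0e ?a0 ?h.
- move=> /(esum_eq0 (p0 b s)) h; rewrite esum1// => x Dx.
  by rewrite (@poweR_eq0_eq0 _ (b x) s) ?mule0 ?b0 ?h.
- move=> t t0.
  have t1 u : 0 <= (t `^ u)%:E by rewrite lee_fin powR_ge0.
  apply: (@le_trans _ _ (\esum_(x in D) ((t `^ r)%:E * a x `^ r + (t `^ (- s))%:E * b x `^ s))).
    by apply: le_esum => x Dx; apply: young_mule => //; [exact: a0|exact: b0].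
  rewrite esumD; try by move=> x Dx; rewrite mule_ge0 ?poweR_ge0.
  by apply: leeD; apply: esumZl_le => //; exact: p0.
Qed.

End esum_extra.

(** * The one-parameter embedding and Minkowski's inequality *)

Section one_parameter.
Context d (T : measurableType d) (R : realType).
Variable mu : {measure set T -> \bar R}.
Local Open Scope ereal_scope.
Implicit Types (D : set (set T)) (f : T -> \bar R).

Lemma ge0_integral_sum_in (E : set T) (I : eqType) (s : seq I)
    (f : I -> T -> \bar R) : measurable E ->
  (forall i, i \in s -> measurable_fun E (f i)) ->
  (forall i x, i \in s -> E x -> 0 <= f i x) ->
  \int[mu]_(x in E) \sum_(i <- s) f i x = \sum_(i <- s) \int[mu]_(x in E) f i x.
Proof.
move=> mE mf f0; under eq_integral do rewrite big_tnth; rewrite big_tnth.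
rewrite ge0_integral_sum//.
- by move=> i; apply: mf; exact: mem_tnth.
- by move=> i x Ex; apply: f0 => //; exact: mem_tnth.
Qed.

(* All that the one-parameter embedding uses of dyadic cubes. *)
Definition lacunary D :=
  [/\ forall Q, D Q -> measurable Q,
      forall Q, D Q -> 0 < mu Q < +oo &
      forall Q Q' x, D Q -> D Q' -> Q != Q' -> Q x -> Q' x ->
        2%:E * mu Q <= mu Q' \/ 2%:E * mu Q' <= mu Q].

Definition embed_const (S rho : R) : R := (4 `^ rho * split_const S rho)%R.

(** This is mu(Q)^(1/S) times the mean of [f] over [Q], the scaling under which it is comparable
    with an L^S norm of [f]. *)
Definition scaled_int (S : R) (Q : set T) f : \bar R :=
  mu Q `^ (S^-1 - 1) * \int[mu]_(x in Q) f x.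

Lemma embed_const_gt0 S rho : (1 < S)%R -> (S < rho)%R -> (0 < embed_const S rho)%R.
Proof.
move=> S1 Sr; have S0 : (0 < S)%R by exact: lt_trans S1.
rewrite mulr_gt0 ?powR_gt0// addr_gt0// geo_const_gt0// subr_gt0.
  by rewrite ltr_pdivlMr// mul1r.
by rewrite invf_lt1.
Qed.

Lemma scaled_int_ge0 S Q f : (forall x, 0 <= f x) -> 0 <= scaled_int S Q f.
Proof. by move=> f0; rewrite mule_ge0 ?poweR_ge0// integral_ge0. Qed.

(** Bound each term by [integral_split_bump] and move the sum under the integral. At a point x only
    the sets containing x contribute; their measures are pairwise a factor 2 apart, so
    [sum_split_bump] applies. *)
Lemma lacunary_embedding_unit D (S rho : R) f :
  lacunary D -> (1 < S)%R -> (S < rho)%R ->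
  measurable_fun setT f -> (forall x, 0 <= f x) ->
  \int[mu]_x (f x `^ S) <= 1 ->
  \esum_(Q in D) (scaled_int S Q f `^ rho) <= (embed_const S rho)%:E.
Proof.
move=> [mD muD sepD] S1 Srho mf f0 If; apply: esum_le_seq => s us sD.
have c0 := embed_const_gt0 S1 Srho.
have S0 : (0 < S)%R by exact: lt_trans S1.
pose del Q := fine (mu Q).
have muE Q : D Q -> mu Q = (del Q)%:E.
  by move=> /muD /andP[m0 moo]; rewrite fineK// ge0_fin_numE.
have del0 Q : D Q -> (0 < del Q)%R.
  by move=> DQ; have /andP[+ _] := muD Q DQ; rewrite muE// lte_fin.
pose F Q := (fun x => split_bump S rho (del Q) (f x)) \_ Q.
have F0 Q x : 0 <= F Q x.
  by rewrite /F patchE; case: ifP => // _; exact: split_bump_ge0.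
have mF Q : D Q -> measurable_fun setT (F Q).
  move=> DQ; apply/(measurable_restrictT _ (mD _ DQ))/measurable_funTS.
  exact: measurable_split_bump.
have q0 : 0 <= (4 `^ rho)%:E by rewrite lee_fin powR_ge0.
apply: (@le_trans _ _ (\sum_(Q <- s) (4 `^ rho)%:E * \int[mu]_x F Q x)).
  rewrite big_seq [leRHS]big_seq; apply: lee_sum => Q /sD DQ.
  rewrite /F -integral_mkcond /scaled_int muE// poweR_EFin.
  by apply: integral_split_bump => //; [exact: mD|exact: muE|exact: del0].
rewrite -ge0_sume_distrr; last by move=> Q _; exact: integral_ge0.
rewrite /embed_const EFinM lee_wpmul2l//.
rewrite -ge0_integral_sum_in//; last by move=> Q /sD /mF.
have k0 : (0 <= split_const S rho)%R.
  by move: c0; rewrite /embed_const pmulr_rgt0 ?powR_gt0// => /ltW.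
apply: (@le_trans _ _ (\int[mu]_x ((split_const S rho)%:E * f x `^ S))); last first.
  rewrite ge0_integralZl_EFin//.
  - by rewrite -[leRHS]mule1 lee_wpmul2l ?lee_fin.
  - by move=> x _; exact: poweR_ge0.
  - exact: measurable_fun_poweR.
apply: ge0_le_integral => //.
- by move=> x _; exact: sume_ge0.
- under eq_fun do rewrite big_tnth; apply: emeasurable_sum => i.
  by apply: mF; apply: sD; exact: mem_tnth.
- by apply: measurable_funeM; exact: measurable_fun_poweR.
move=> x _; rewrite (bigID (fun Q => x \in Q))/= [X in _ + X]big1 ?adde0; last first.
  by move=> Q /negbTE; rewrite /F patchE => ->.
rewrite (eq_bigr (fun Q => split_bump S rho (del Q) (f x))); last first.
  by move=> Q xQ; rewrite /F patchE xQ.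
rewrite -big_filter; apply: sum_split_bump => //; first exact: filter_uniq.
- by move=> Q; rewrite mem_filter => /andP[_ /sD /del0].
- move=> Q Q'; rewrite !mem_filter =>
  /andP[/set_mem xQ /sD DQ] /andP[/set_mem xQ' /sD DQ'] QQ'.
  by have := sepD Q Q' x DQ DQ' QQ' xQ xQ'; rewrite !muE// -!EFinM !lee_fin.
Qed.

Lemma integral_poweR_eq0_scaled_int Q (S : R) f : measurable Q ->
  measurable_fun setT f -> (forall x, 0 <= f x) ->
  \int[mu]_x (f x `^ S) = 0 -> scaled_int S Q f = 0.
Proof.
move=> mQ mf f0 If.
have fS0 x : 0 <= f x `^ S by exact: poweR_ge0.
have : \int[mu]_(x in Q) (f x `^ S) = 0.
  apply/eqP; rewrite eq_le integral_ge0// andbT -If ge0_subset_integral//.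
  exact: measurable_fun_poweR.
move=> /(@integral_poweR_eq0 _ _ _ mu Q f (cst 1)) h.
rewrite /scaled_int; under eq_integral do rewrite -[f _]mule1.
by rewrite h ?mule0//; exact: measurable_funTS.
Qed.

Lemma lacunary_embedding D (S rho : R) f :
  lacunary D -> (1 < S)%R -> (S < rho)%R ->
  measurable_fun setT f -> (forall x, 0 <= f x) ->
  \esum_(Q in D) (scaled_int S Q f `^ rho) <=
    (embed_const S rho)%:E * (\int[mu]_x (f x `^ S)) `^ (rho / S).
Proof.
move=> lD S1 Srho mf f0.
have c0 := embed_const_gt0 S1 Srho.
have S0 : (0 < S)%R by exact: lt_trans S1.
have rho0 : (0 < rho)%R by exact: lt_trans Srho.
have rS0 : (0 < rho / S)%R by rewrite divr_gt0.
set I := \int[mu]_x _.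
have I0 : 0 <= I by apply: integral_ge0 => x _; exact: poweR_ge0.
have [Iy|Iy] := eqVneq I +oo.
  by rewrite Iy poweRyr ?gt_eqF// gt0_muley ?lte_fin// leey.
have [Iz|Iz] := eqVneq I 0.
  rewrite esum1; first by rewrite mule_ge0 ?poweR_ge0// lee_fin ltW.
  move=> Q DQ; rewrite (integral_poweR_eq0_scaled_int _ mf f0 Iz) ?poweR0r ?gt_eqF//.
  by have [+ _ _] := lD; exact.
have Ifin : I \is a fin_num by rewrite ge0_fin_numE// lt_neqAle Iy leey.
have i0 : (0 < fine I)%R by rewrite fine_gt0// lt0e Iz I0/= lt_neqAle Iy leey.
pose c : R := (fine I `^ (- S^-1))%R.
have c1 : (0 < c)%R by exact: powR_gt0.
have cI : (c `^ S * fine I = 1)%R.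
  by rewrite /c -powRrM mulNr mulVf ?gt_eqF// powR_inv1 ?(ltW i0)// mulVf// gt_eqF.
have cM x : 0 <= c%:E * f x by rewrite mule_ge0// lee_fin ltW.
have mcf : measurable_fun setT (fun x => c%:E * f x) by exact: measurable_funeM.
have := @lacunary_embedding_unit D S rho (fun x => c%:E * f x) lD S1 Srho mcf cM.
under eq_integral do rewrite poweRM ?lee_fin ?(ltW c1)// poweR_EFin.
rewrite ge0_integralZl_EFin ?powR_ge0//; last 2 first.
- by move=> x _; exact: poweR_ge0.
- exact: measurable_fun_poweR.
rewrite -/I -{1}(fineK Ifin) -EFinM cI => /(_ (lexx _)) H.
have cr0 : (0 < c `^ rho)%R by exact: powR_gt0.
have cr1 : ((c `^ rho)^-1 = fine I `^ (rho / S))%R.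
  rewrite -powR_inv1 ?(ltW cr0)// /c -!powRrM; congr (_ `^ _)%R.
  by field; rewrite gt_eqF.
rewrite -(fineK Ifin) poweR_EFin -cr1.
apply: (@le_trans _ _ ((c `^ rho)^-1%:E * \esum_(Q in D) (scaled_int S Q (fun x =>
  c%:E * f x) `^ rho))); last first.
  by rewrite [leRHS]muleC lee_wpmul2l// lee_fin invr_ge0 ltW.
apply: esum_le_seq => s us sD.
apply: (@le_trans _ _ ((c `^ rho)^-1%:E * \sum_(Q <- s) (scaled_int S Q (fun x =>
  c%:E * f x) `^ rho))); last first.
  rewrite lee_wpmul2l ?lee_fin ?invr_ge0 ?(ltW cr0)//.
  by apply: seq_le_esum => // Q _; exact: poweR_ge0.
rewrite ge0_sume_distrr; last by move=> Q _; exact: poweR_ge0.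
rewrite big_seq [leRHS]big_seq; apply: lee_sum => Q /sD DQ.
rewrite /scaled_int ge0_integralZl_EFin ?(ltW c1)//; last 2 first.
- by have [+ _ _] := lD; exact.
- exact: measurable_funTS.
rewrite [in leRHS]muleCA [in leRHS]poweRM ?lee_fin ?(ltW c1)//;
  last exact: scaled_int_ge0.
rewrite [leRHS]muleA [in leRHS]poweR_EFin -EFinM mulVf ?mul1e// gt_eqF//.
Qed.

(** Minkowski's integral inequality for the l^rho norm, up to a factor 2. A measurable majorant [f]
    stands in for the pointwise l^rho norm, so that the measurability of a sum over an arbitrary [J]
    never arises. *)
Lemma esum_poweR_integral_le (I : choiceType) (J : set I) (E : set T)
    (g : I -> T -> \bar R) f (rho : R) :
  measurable E -> (1 < rho)%R ->
  (forall j, J j -> measurable_fun E (g j)) -> (forall j x, 0 <= g j x) ->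
  measurable_fun E f -> (forall x, 0 <= f x) ->
  (forall x, \esum_(j in J) (g j x `^ rho) <= f x `^ rho) ->
  \esum_(j in J) ((\int[mu]_(x in E) g j x) `^ rho) <=
    (2 `^ rho)%:E * (\int[mu]_(x in E) f x) `^ rho.
Proof.
move=> mE rho1 mg g0 mf f0 H; apply: esum_le_seq => s us sJ.
have rho0 : (0 < rho)%R by exact: lt_trans rho1.
have {}H x : \sum_(j <- s) (g j x `^ rho) <= f x `^ rho.
  apply: le_trans (H x); apply: seq_le_esum => // j _; exact: poweR_ge0.
(* Each term lies below the l^rho norm; hence the integrals [G j] are finite as soon as [I0] is. *)
have gf j x : j \in s -> g j x <= f x.
  move=> js; have : g j x `^ rho <= f x `^ rho.
    apply: le_trans (H x); rewrite (perm_big _ (perm_to_rem js))/= big_cons leeDl//.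
    by apply: sume_ge0 => *; exact: poweR_ge0.
  move=> h; rewrite -(poweRK rho0 (g0 j x)) -[leRHS](poweRK rho0 (f0 x)).
  by apply: gee0_ler_poweR; rewrite ?invr_ge0 ?poweR_ge0 ?(ltW rho0).
set I0 := \int[mu]_(x in E) f x.
have I00 : 0 <= I0 by exact: integral_ge0.
have t0 : (0 < 2 `^ rho :> R)%R by exact: powR_gt0.
have [Iy|Iy] := eqVneq I0 +oo.
  by rewrite Iy poweRyr ?gt_eqF// gt0_muley ?lte_fin// leey.
pose G j := \int[mu]_(x in E) g j x.
have G0 j : 0 <= G j by exact: integral_ge0.
have GI j : j \in s -> G j <= I0.
  by move=> js; apply: ge0_le_integral => //; [exact/mg/sJ|move=> x _; exact: gf].
have Gfin j : j \in s -> G j \is a fin_num.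
  by move=> js; rewrite ge0_fin_numE// (le_lt_trans (GI j js))// lt_neqAle Iy leey.
pose w j := fine (G j).
have w0 j : (0 <= w j)%R by exact: fine_ge0.
have GE j : j \in s -> G j = (w j)%:E by move=> js; rewrite fineK// Gfin.
pose W := (\sum_(j <- s) w j `^ rho)%R.
have W0 : (0 <= W)%R by apply: sumr_ge0 => j _; exact: powR_ge0.
have -> : \sum_(j <- s) (G j `^ rho) = W%:E.
  rewrite -sumEFin big_seq [RHS]big_seq; apply: eq_bigr => j js.
  by rewrite GE// poweR_EFin.
have If : I0 \is a fin_num by rewrite ge0_fin_numE// lt_neqAle Iy leey.
rewrite le_eqVlt in W0; case/predU1P: W0 => [<-|W0].
  by rewrite mule_ge0 ?poweR_ge0// lee_fin ltW.
pose t := (W `^ rho^-1)%R.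
have tp : (0 < t)%R by exact: powR_gt0.
have tW : (t `^ rho = W)%R by rewrite /t -powRrM mulVf ?gt_eqF// powRr1// ltW.
(* Duality: test against the weights [(w j / t) `^ (rho - 1)], of unit norm in
   the dual of l^rho. *)
have key x : \sum_(j <- s) ((w j / t) `^ (rho - 1))%:E * g j x <= 2%:E * f x.
  have [fy|fy] := eqVneq (f x) +oo; first by rewrite fy gt0_muley ?lte_fin// leey.
  have ff : f x \is a fin_num by rewrite ge0_fin_numE// lt_neqAle fy leey.
  have [fz|fz] := eqVneq (f x) 0.
    rewrite big_seq big1 ?fz ?mule0// => j js.
    have -> : g j x = 0 by apply/eqP; rewrite eq_le g0 andbT -fz gf.
    by rewrite mule0.
  have fp : (0 < fine (f x))%R by rewrite fine_gt0// lt0e fz f0/= lt_neqAle fy leey.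
  have gfin j : j \in s -> g j x = (fine (g j x))%:E.
    move=> js; rewrite fineK// ge0_fin_numE// (le_lt_trans (gf j x js))//.
    by rewrite lt_neqAle fy leey.
  rewrite big_seq (eq_bigr (fun j => ((w j / t) `^ (rho - 1) * fine (g j x))%:E));
    last first.
    by move=> j js; rewrite EFinM -gfin.
  rewrite -big_seq sumEFin -(fineK ff) -EFinM lee_fin.
  have Hx : (\sum_(j <- s) fine (g j x) `^ rho <= fine (f x) `^ rho)%R.
    have := H x; rewrite -(fineK ff) poweR_EFin big_seq.
    rewrite (eq_bigr (fun j => (fine (g j x) `^ rho)%:E)) -?big_seq ?sumEFin ?lee_fin//.
    by move=> j js; rewrite [in LHS]gfin// poweR_EFin.
  pose v j := (fine (g j x) / fine (f x))%R.
  have v0 j : (0 <= v j)%R by rewrite divr_ge0// fine_ge0.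
  (* A crude Young inequality, u^(rho-1) v <= u^rho + v^rho, obtained by comparing with the larger
     of u and v. Both sums of powers are at most 1 after normalisation, hence the factor 2. *)
  apply: (@le_trans _ _ (\sum_(j <- s) fine (f x) * ((w j / t) `^ rho + v j `^ rho))%R).
    apply: ler_sum => j _.
    have -> : fine (g j x) = (fine (f x) * v j)%R by rewrite /v mulrCA divff ?mulr1//
      gt_eqF.
    rewrite mulrCA ler_pM2l//.
    have u0 : (0 <= w j / t)%R by rewrite divr_ge0// ltW.
    set u := (w j / t)%R in u0 *.
    have r1 : (0 <= rho - 1)%R by rewrite subr_ge0 ltW.
    have [uv|vu] := leP u (v j).
      rewrite (@le_trans _ _ (v j `^ rho)%R) ?lerDr ?powR_ge0//.
      rewrite -[leRHS]mulr_powRB1 ?v0// mulrC ler_wpM2l ?v0//.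
      by apply: ge0_ler_powR => //; rewrite nnegrE.
    rewrite (@le_trans _ _ (u `^ rho)%R) ?lerDl ?powR_ge0//.
    by rewrite -[leRHS]mulr_powRB1 ?u0// mulrC ler_wpM2r ?powR_ge0 ?(ltW vu).
  rewrite -mulr_sumr mulrC ler_pM2r// big_split/=.
  have -> : (2 = 1 + 1 :> R)%R by [].
  apply: lerD.
    under eq_bigr do rewrite powRM ?invr_ge0 ?w0 ?(ltW tp)//.
    rewrite -mulr_suml -/W -powR_inv1 ?(ltW tp)// -powRrM mulrC mulN1r powRN tW.
    by rewrite mulVf// gt_eqF.
  under eq_bigr do rewrite powRM ?invr_ge0 ?fine_ge0//.
  rewrite -mulr_suml -powR_inv1 ?(ltW fp)// -powRrM mulN1r powRN.
  by rewrite ler_pdivrMr ?powR_gt0// mul1r.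
have : \int[mu]_(x in E) \sum_(j <- s) ((w j / t) `^ (rho - 1))%:E * g j x <= \int[mu]_(x in E) (2%:E * f x).
  apply: ge0_le_integral => //.
  - by move=> x _; apply: sume_ge0 => j _; rewrite mule_ge0// lee_fin powR_ge0.
  - under eq_fun do rewrite big_tnth; apply: emeasurable_sum => i.
    by apply: measurable_funeM; apply/mg/sJ; exact: mem_tnth.
  - exact: measurable_funeM.
rewrite ge0_integral_sum_in//; last 2 first.
- by move=> j /sJ /mg mgj; exact: measurable_funeM.
- by move=> j x _ _; rewrite mule_ge0// lee_fin powR_ge0.
rewrite ge0_integralZl_EFin// big_seq.
rewrite (eq_bigr (fun j => ((w j / t) `^ (rho - 1) * w j)%:E)); last first.
  by move=> j js; rewrite ge0_integralZl_EFin ?powR_ge0//;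
    [rewrite -/(G j) GE|exact/mg/sJ].
rewrite -big_seq sumEFin -/I0 -(fineK If) -EFinM !lee_fin.
(* With these weights the left side is W / t^(rho-1) = t, so the inequality reads t <= 2 [I0]; its
   power [rho] is the claim. *)
rewrite (eq_bigr (fun j => w j `^ rho / t `^ (rho - 1))%R); last first.
  move=> j _; rewrite powRM ?invr_ge0 ?(ltW tp)// -[(t^-1)%R]powR_inv1 ?(ltW tp)//.
  by rewrite -powRrM mulN1r powRN mulrAC [(_ * w j)%R]mulrC mulr_powRB1.
rewrite -mulr_suml -/W -{1}tW -[(t `^ rho)%R]mulr_powRB1 ?(ltW tp)//
  mulfK ?gt_eqF ?powR_gt0//.
move=> tI; rewrite -tW -powRM ?fine_ge0//.
by apply: ge0_ler_powR; rewrite ?nnegrE ?(ltW rho0) ?(ltW tp)// mulr_ge0// fine_ge0.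
Qed.

End one_parameter.

(** * The embedding for rectangles *)

Section product_embedding.
Context d1 d2 (T1 : measurableType d1) (T2 : measurableType d2) (R : realType).
Variables (m1 : {sigma_finite_measure set T1 -> \bar R})
          (m2 : {sigma_finite_measure set T2 -> \bar R}).
Local Open Scope ereal_scope.

(** Extending [f] by zero off the strip over [J] turns this into the measurability statement of
    Tonelli's theorem. *)
Lemma measurable_fun_integral_section (J : set T2) (f : T1 * T2 -> \bar R) :
  measurable J -> measurable_fun setT f -> (forall z, 0 <= f z) ->
  measurable_fun setT (fun x => \int[m2]_(y in J) f (x, y)).
Proof.
move=> mJ mf f0; pose g := f \_ (setT `*` J).
have mg : measurable_fun setT g.
  by apply/(measurable_restrictT _ (measurableX measurableT mJ)); exact: measurable_funTS.
have g0 z : 0 <= g z by rewrite /g patchE; case: ifP.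
have := measurable_fun_fubini_tonelli_F (m2 := m2) _ mg g0.
congr measurable_fun; apply/funext => x; rewrite /fubini_F [RHS]integral_mkcond.
apply: eq_integral => y _; rewrite /g !patchE; congr (if _ then _ else _).
by apply/idP/idP => /set_mem h; apply/mem_set => //; case: h.
Qed.

Lemma ge0_integral_rectangle (I : set T1) (J : set T2) (f : T1 * T2 -> \bar R) :
  measurable I -> measurable J -> measurable_fun setT f ->
  (forall z, 0 <= f z) ->
  \int[m1 \x m2]_(z in I `*` J) f z = \int[m1]_(x in I) \int[m2]_(y in J) f (x, y).
Proof.
move=> mI mJ mf f0; rewrite integral_mkcond [RHS]integral_mkcond.
rewrite fubini_tonelli1; last 2 first.
- by apply/(measurable_restrictT _ (measurableX mI mJ)); exact: measurable_funTS.
- by move=> z; rewrite patchE; case: ifP.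
apply: eq_integral => x _; rewrite /fubini_F patchE; case: ifPn => xI.
  rewrite [RHS]integral_mkcond; apply: eq_integral => y _.
  rewrite !patchE; congr (if _ then _ else _).
  by apply/idP/idP => /set_mem h; apply/mem_set; [case: h|split => //; exact: set_mem].
rewrite integral0_eq// => y _; rewrite patchE ifF//; apply/negP => /set_mem[/= xI' _].
by move: xI; rewrite mem_set.
Qed.

(** Each parameter contributes one factor [embed_const], and Minkowski's inequality between them
    contributes 2^rho. *)
Lemma product_embedding (D1 : set (set T1)) (D2 : set (set T2)) (S rho : R)
    (f : T1 * T2 -> \bar R) :
  lacunary m1 D1 -> lacunary m2 D2 -> (1 < S)%R -> (S < rho)%R ->
  measurable_fun setT f -> (forall z, 0 <= f z) ->
  \esum_(I in D1) \esum_(J in D2)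
    ((m1 I `^ (S^-1 - 1) * m2 J `^ (S^-1 - 1) *
      \int[m1 \x m2]_(z in I `*` J) f z) `^ rho) <=
  (2 `^ rho * embed_const S rho ^+ 2)%:E *
    (\int[m1 \x m2]_z (f z `^ S)) `^ (rho / S).
Proof.
move=> l1 l2 S1 Srho mf f0.
have [mD1 _ _] := l1; have [mD2 _ _] := l2.
have S0 : (0 < S)%R by exact: lt_trans S1.
have rho0 : (0 < rho)%R by exact: lt_trans Srho.
have rho1 : (1 < rho)%R by exact: lt_trans Srho.
have rS0 : (0 < rho / S)%R by rewrite divr_gt0.
set C1 := embed_const S rho.
have C10 : (0 < C1)%R by exact: embed_const_gt0.
have mfS : measurable_fun setT (fun z => f z `^ S) by exact: measurable_fun_poweR.
have fS0 z : 0 <= f z `^ S by exact: poweR_ge0.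
have mfx x : measurable_fun setT (fun y => f (x, y)).
  exact: (measurableT_comp mf (pair1_measurable x)).
pose g J x := scaled_int m2 S J (fun y => f (x, y)).
have g0 J x : 0 <= g J x by exact: scaled_int_ge0.
have mg J : D2 J -> measurable_fun setT (g J).
  by move=> DJ; apply/measurable_funeM/measurable_fun_integral_section => //; exact: mD2.
pose N x := \int[m2]_y (f (x, y) `^ S).
have N0 x : 0 <= N x by exact: integral_ge0.
have mN : measurable_fun setT N.
  exact: (@measurable_fun_integral_section setT (fun z => f z `^ S)).
(* The majorant for Minkowski: the L^S norm of the section, scaled so that phi^rho is exactly the
   bound of the embedding in y. *)
pose phi x := (C1 `^ rho^-1)%:E * N x `^ S^-1.
have c0 : 0 <= (C1 `^ rho^-1)%:E by rewrite lee_fin powR_ge0.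
have phi0 x : 0 <= phi x by rewrite mule_ge0// poweR_ge0.
have mphi : measurable_fun setT phi by exact/measurable_funeM/measurable_fun_poweR.
have Hx x : \esum_(J in D2) (g J x `^ rho) <= phi x `^ rho.
  rewrite /phi poweRM ?poweR_ge0// poweR_EFin -powRrM mulVf ?gt_eqF// powRr1 ?(ltW C10)//.
  by rewrite -poweRrM [(S^-1 * _)%R]mulrC; exact: lacunary_embedding.
have step I : D1 I ->
    \esum_(J in D2) ((m1 I `^ (S^-1 - 1) * m2 J `^ (S^-1 - 1) *
      \int[m1 \x m2]_(z in I `*` J) f z) `^ rho) <=
    (2 `^ rho)%:E * (scaled_int m1 S I phi `^ rho).
  move=> DI; have mI := mD1 _ DI.
  rewrite /scaled_int poweRM ?poweR_ge0 ?integral_ge0// muleCA.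
  apply: (@le_trans _ _ ((m1 I `^ (S^-1 - 1)) `^ rho *
     \esum_(J in D2) ((\int[m1]_(x in I) g J x) `^ rho))); last first.
    rewrite lee_wpmul2l ?poweR_ge0//; apply: esum_poweR_integral_le => //.
    - by move=> J DJ; exact/measurable_funTS/mg.
    - exact: measurable_funTS.
  apply: le_trans (esumZl_le _ _) => //; rewrite ?poweR_ge0//; last by move=> J _;
    exact: poweR_ge0.
  apply: le_esum => J DJ; have mJ := mD2 _ DJ.
  rewrite ge0_integral_rectangle// -muleA poweRM ?poweR_ge0//; last first.
    rewrite mule_ge0 ?poweR_ge0//; apply: integral_ge0 => x _; exact: integral_ge0.
  rewrite [X in _ <= _ * X `^ _]ge0_integralZl ?poweR_ge0//.
  - by apply/measurable_funTS/measurable_fun_integral_section.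
  - by move=> x _; exact: integral_ge0.
apply: le_trans (le_esum step) _.
apply: le_trans (esumZl_le _ _) _; rewrite ?lee_fin ?powR_ge0//.
  by move=> I _; exact: poweR_ge0.
rewrite EFinM -muleA lee_wpmul2l ?lee_fin ?powR_ge0//.
apply: le_trans (lacunary_embedding l1 S1 Srho mphi phi0) _.
rewrite -/C1 expr2 (EFinM C1 C1) -(muleA C1%:E) lee_wpmul2l ?lee_fin ?(ltW C10)//.
(* Since phi^S = C1^(S/rho) N, the outer power rho/S releases a second factor C1, and Tonelli's
   theorem recombines the integral of N. *)
rewrite (eq_integral (fun x => (C1 `^ (S / rho))%:E * N x)); last first.
  move=> x _; rewrite /phi poweRM ?poweR_ge0// poweRVK// poweR_EFin -powRrM.
  by rewrite [(rho^-1 * _)%R]mulrC.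
rewrite ge0_integralZl_EFin ?powR_ge0// poweRM ?lee_fin ?powR_ge0//; last first.
  by apply: integral_ge0 => x _.
rewrite poweR_EFin -powRrM (_ : S / rho * _ = 1)%R ?powRr1 ?(ltW C10)//; last first.
  by field; rewrite !gt_eqF.
by rewrite fubini_tonelli1.
Qed.

End product_embedding.

(** * Completed measures *)

Section completion.
Context d (T : measurableType d) (R : realType).
Variable mu : {measure set T -> \bar R}.
Local Open Scope ereal_scope.
Let cT := caratheodory_type (mu^*)%mu.
Let cmu : {measure set cT -> \bar R} :=
  [the {measure set cT -> \bar R} of @completed_measure_extension _ _ _ mu].

Lemma measurable_completion (A : set T) : measurable A -> measurable (A : set cT).
Proof. exact: caratheodory_measurable_mu_ext. Qed.

Lemma completionE (A : set T) : measurable A -> cmu A = mu A.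
Proof. exact: measurable_mu_extE. Qed.

Lemma measurable_fun_completion (g : T -> \bar R) :
  measurable_fun setT g -> measurable_fun setT (g : cT -> \bar R).
Proof.
move=> mg _ Y mY; have := mg measurableT Y mY.
by rewrite !setTI => /measurable_completion.
Qed.

(** The identity map from the completed space to the original one is measurable and pushes the
    completed measure forward to [mu]. *)
Lemma ge0_integral_completion (Q : set T) (g : T -> \bar R) :
  measurable Q -> measurable_fun setT g -> (forall x, 0 <= g x) ->
  \int[cmu]_(x in Q) g x = \int[mu]_(x in Q) g x.
Proof.
move=> mQ mg g0.
have mid : measurable_fun setT (id : cT -> T).
  by move=> _ Y mY; rewrite setTI; exact: measurable_completion.
have := @ge0_integral_pushforward _ _ cT T R id mid cmu Q g mQ.
move=> /(_ (measurable_funTS mg) (fun y _ => g0 y)) /= <-.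
apply: eq_measure_integral => A mA _.
exact: completionE.
Qed.

(** A measurable hull: intersect countable covers whose total mass exceeds the outer measure by less
    than 1/(n+1). *)
Lemma outer_measurable_cover (A : set T) : cmu A < +oo ->
  exists2 B, measurable B & A `<=` B /\ mu B = cmu A.
Proof.
move=> Aoo.
have cmu_ge0 : 0 <= cmu A by exact: outer_measure_ge0.
have cov n : exists2 F, measurable_cover A F &
   \sum_(0 <= k <oo) mu (F k) < cmu A + n.+1%:R^-1%:E.
  have n0 : (0 < n.+1%:R^-1 :> R)%R by rewrite invr_gt0.
  have : cmu A \is a fin_num by rewrite ge0_fin_numE.
  by move/lb_ereal_inf_adherent => /(_ _ n0)[_/= [F AF] <-] ?; exists F.
pose F n := projT1 (cid2 (cov n)).
have AF n : measurable_cover A (F n) by rewrite /F; case: cid2.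
have muF n : \sum_(0 <= k <oo) mu (F n k) < cmu A + n.+1%:R^-1%:E.
  by rewrite /F; case: cid2.
pose B n := \bigcup_k (F n k).
have mF n k : measurable (F n k) by have [/(_ k)] := AF n.
have mB n : measurable (B n) by exact: bigcupT_measurable.
have AB n : A `<=` B n by have [] := AF n.
have mBB : measurable (\bigcap_n B n) by exact: bigcapT_measurable.
exists (\bigcap_n B n) => //; split; first exact: sub_bigcap.
apply/eqP; rewrite eq_le; apply/andP; split; last first.
  by rewrite -completionE//; apply: le_outer_measure; exact: sub_bigcap.
apply/lee_addgt0Pr => _/posnumP[e]; near \oo => n.
apply: (@le_trans _ _ (mu (B n))).
  by apply: le_measure; rewrite ?inE//; exact: bigcap_inf.
apply: (@le_trans _ _ (\sum_(0 <= k <oo) mu (F n k))).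
  exact: measure_sigma_subadditive.
apply: le_trans (ltW (muF n)) _; rewrite leeD2l// lee_fin ltW//.
near: n; exact: near_infty_natSinv_lt.
Unshelve. all: by end_near. Qed.

(* A function with superlevel sets of finite measure agrees almost everywhere
   with the supremum, over positive rationals [q], of [q] times the indicator
   of a measurable hull of [f > q]. *)
Lemma completion_ae_eq (f : cT -> \bar R) : measurable_fun setT f ->
  (forall x, 0 <= f x) ->
  (forall r : R, (0 < r)%R -> cmu [set x | r%:E < f x] < +oo) ->
  exists g : T -> \bar R, [/\ measurable_fun setT g, (forall x, 0 <= g x) &
    ae_eq cmu setT f g].
Proof.
move=> mf f0 flt.
(* An enumeration of the positive rationals; codes of anything else get the harmless positive value
   1. *)
pose q n : R := if unpickle n is Some q then if (0 < q :> rat)%R then ratr q else 1%R else 1%R.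
have q0 n : (0 < q n)%R.
  by rewrite /q; case: unpickle => // a; case: ifPn => // a0; rewrite ltr0q.
have cov n : exists B : set T, [/\ measurable B, [set x | (q n)%:E < f x] `<=` B &
    mu B = cmu [set x | (q n)%:E < f x]].
  by have [B mB [AB e]] := outer_measurable_cover (flt _ (q0 n)); exists B.
pose B n := projT1 (cid (cov n)).
have BP n : [/\ measurable (B n), [set x | (q n)%:E < f x] `<=` B n &
    mu (B n) = cmu [set x | (q n)%:E < f x]].
  by rewrite /B; case: cid.
have mA n : measurable ([set x | (q n)%:E < f x] : set cT).
  by rewrite -[X in measurable X]setTI; exact: emeasurable_fun_o_infty.
pose h n x : \bar R := (q n * \1_(B n) x)%:E.
have h0 n x : 0 <= h n x by rewrite lee_fin mulr_ge0// ltW.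
exists (fun x => esups (h ^~ x) 0%N); split.
- apply: measurable_fun_esups => n; apply/measurable_EFinP.
  apply: measurable_funM; first exact: measurable_cst.
  by apply: measurable_indic; have [] := BP n.
- move=> x; apply: le_trans (h0 0%N x) _.
  by apply: ereal_sup_ubound; exists 0%N.
(* Each hull exceeds its superlevel set by a null set, by equality of finite measures; countably
   many null sets are discarded. *)
have : \forall x \ae cmu, forall n, B n x -> (q n)%:E < f x.
  apply/ae_foralln => n; exists (B n `\` [set x | (q n)%:E < f x]).
  have [mB AB muB] := BP n.
  have mcB := measurable_completion mB.
  have fl := flt _ (q0 n).
  split; first exact: measurableD.
    rewrite [LHS]measureD//=; last by rewrite [ltLHS](completionE mB) muB.
    rewrite setIidr// [X in X - _](completionE mB) muB subee//.
    by rewrite ge0_fin_numE.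
  by move=> x /= /not_implyP[].
move=> [N [mN N0 HN]]; exists N; split => // x /= nfx.
apply: HN => /= Bx; apply: nfx => _.
apply/eqP; rewrite eq_le; apply/andP; split; last first.
  apply: ge_ereal_sup => _ /= [n _ <-]; rewrite /h indicE.
  case: (boolP (x \in B n)) => xB; last by rewrite mulr0.
  by rewrite mulr1 ltW//; apply: Bx; exact: set_mem.
set g := esups _ _; rewrite leNgt; apply/negP => gf.
have g0 : 0 <= g by apply: le_trans (h0 0%N x) _; apply: ereal_sup_ubound; exists 0%N.
(* If the supremum were below f(x), a rational strictly between them would index a hull containing x
   and force the supremum above itself. *)
have [r /andP[gr rf]] : exists r : R, (g < r%:E) && (r%:E < f x).
  clear -gf g0; move: gf; case: (f x) => [y| |]; last by rewrite ltNge leNye.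
    move: g0; case: g => [u| |]// u0 uy; rewrite lte_fin in uy.
    exists ((u + y) / 2)%R; rewrite !lte_fin midf_lt//=.
    by rewrite ltr_pdivrMr// mulr_natr mulr2n ltrD2r.
  move: g0; case: g => [u| |]// u0 _; exists (u + 1)%R.
  by rewrite lte_fin ltrDl ltr01 ltry.
have gfin : g \is a fin_num by rewrite ge0_fin_numE// (lt_trans gr) ?ltry.
have : (fine g < r)%R by rewrite -lte_fin fineK.
move=> /rat_in_itvoo[a]; rewrite in_itv/= => /andP[ga ar].
have a0 : (0 < a)%R.
  by rewrite -(ltr0q R) (le_lt_trans _ ga)// fine_ge0.
have qa : q (pickle a) = ratr a by rewrite /q pickleK a0.
have af : (q (pickle a))%:E < f x by rewrite qa (lt_trans _ rf)// lte_fin.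
have Ba : B (pickle a) x by have [_ AB _] := BP (pickle a); exact: AB.
have : h (pickle a) x <= g by apply: ereal_sup_ubound; exists (pickle a).
rewrite /h indicE mem_set// mulr1 qa leNgt -(fineK gfin) lte_fin ga//.
Qed.

(** Chebyshev's inequality for f^S at height r^S; it supplies the finiteness required by
    [completion_ae_eq]. *)
Lemma integral_poweR_fin_superlevel (f : cT -> \bar R) (S r : R) :
  (0 < S)%R -> (0 < r)%R -> measurable_fun setT f -> (forall x, 0 <= f x) ->
  \int[cmu]_x (f x `^ S) < +oo -> cmu [set x | r%:E < f x] < +oo.
Proof.
move=> S0 r0 mf f0 If.
have rS : (0 < r `^ S)%R by exact: powR_gt0.
have := @le_integral_abse _ _ _ cmu setT measurableT (fun x =>
  f x `^ S) _ (measurable_fun_poweR S mf) rS.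
rewrite setTI => H.
have rm : measurable ([set x | r%:E < f x] : set cT).
  by have := emeasurable_fun_o_infty measurableT mf r%:E; rewrite setTI.
have mfS : measurable_fun setT (fun x => `|f x `^ S|).
  exact/measurableT_comp/measurable_fun_poweR.
have rm' : measurable ([set x | (r `^ S)%:E <= `|f x `^ S|] : set cT).
  by have := emeasurable_fun_c_infty measurableT mfS (r `^ S)%:E; rewrite setTI.
apply: (@le_lt_trans _ _ (cmu [set x | (r `^ S)%:E <= `|f x `^ S|])).
  apply: le_measure; rewrite ?inE// => x /= rf.
  rewrite gee0_abs ?poweR_ge0// -poweR_EFin.
  by apply: gee0_ler_poweR; rewrite ?lee_fin ?ltW.
have fin : \int[cmu]_x `|f x `^ S| < +oo.
  by under eq_integral do rewrite gee0_abs ?poweR_ge0//.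
have := le_lt_trans H fin; rewrite !ltNge; apply: contra; rewrite !leye_eq => /eqP ->.
by rewrite gt0_muley// lte_fin.
Qed.

(** Tonelli's theorem is applied on the product sigma-algebra, so a Lebesgue measurable function is
    first replaced by an almost everywhere equal one measurable for the smaller sigma-algebra. *)
Lemma completion_integrals (f : cT -> \bar R) (S : R) : (0 < S)%R ->
  measurable_fun setT f -> (forall x, 0 <= f x) ->
  \int[cmu]_x (f x `^ S) < +oo ->
  exists g : T -> \bar R, [/\ measurable_fun setT g, (forall x, 0 <= g x),
    \int[cmu]_x (f x `^ S) = \int[mu]_x (g x `^ S) &
    forall Q : set T, measurable Q -> \int[cmu]_(x in Q) f x = \int[mu]_(x in Q) g x].
Proof.
move=> S0 mf f0 If.
have [g [mg g0 fg]] := completion_ae_eq mf f0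
  (fun r r0 => integral_poweR_fin_superlevel S0 r0 mf f0 If).
have mcg := measurable_fun_completion mg.
exists g; split => //.
- rewrite -ge0_integral_completion//; last 2 first.
  + exact: measurable_fun_poweR.
  + by move=> x; exact: poweR_ge0.
  have mgS := measurable_fun_completion (measurable_fun_poweR S mg).
  apply: (@ae_eq_integral _ _ _ cmu setT (fun x =>
    g x `^ S) _ measurableT (measurable_fun_poweR S mf) mgS).
  by case: fg => N [mN N0 HN]; exists N; split => // x /= h; apply: HN => /= e;
    apply: h => /e ->.
- move=> Q mQ; rewrite -ge0_integral_completion//.
  apply: (@ae_eq_integral _ _ _ cmu Q g _ (measurable_completion mQ) (measurable_funTS mf)
    (measurable_funTS mcg)).
  by case: fg => N [mN N0 HN]; exists N; split => // x /= h; apply: HN => /= e;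
    apply: h => _; exact: e.
Qed.
End completion.

(** * Dyadic grids *)

Section cubes.
Variable R : realType.
Local Open Scope ereal_scope.

Lemma measurable_cube N (a : tupleR R N) (s : R) : measurable (cube a s).
Proof.
rewrite (_ : cube a s = \big[setI/setT]_(i < N)
    ((fun x : tupleR R N => tnth x i) @^-1` `[tnth a i, (tnth a i + s)%R[)).
  apply: bigsetI_measurable => i _; rewrite -[X in measurable X]setTI.
  by apply: measurable_tnth => //; exact: measurable_itv.
rewrite -bigcap_seq; apply/seteqP; split => x /= h i.
  by move=> _ /=; rewrite in_itv/=; exact: h.
by have := h i (mem_index_enum i); rewrite /= in_itv.
Qed.

Lemma preimage_tcons_cube N (a : tupleR R N.+1) (s : R) :
  @tcons R N @^-1` cube a s =
    `[tnth a ord0, (tnth a ord0 + s)%R[%classic `*` cube [tuple of behead a] s.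
Proof.
apply/seteqP; split => [[x t] /= h|[x t] /= [h1 h2] i].
  split; first by have := h ord0; rewrite in_itv/= (tnth_nth x).
  move=> i; have := h (lift ord0 i).
  by rewrite !(tnth_nth x)/= nth_behead.
case: (unliftP ord0 i) => [j ->|->].
  by have := h2 j; rewrite !(tnth_nth x)/= nth_behead.
by move: h1; rewrite in_itv/= !(tnth_nth x).
Qed.

Lemma lebesgue_cube N (a : tupleR R N) (s : R) : (0 < s)%R ->
  (lebesgue_tuple N : {measure set _ -> \bar R}) (cube a s) = (s ^+ N)%:E.
Proof.
move=> s0 /=; elim: N a => [a|N ih a].
  by rewrite expr0 /= diracE mem_set// => -[].
rewrite /= /tcons_measure /pushforward preimage_tcons_cube.
rewrite product_measure1E//; last exact: measurable_cube.
rewrite ih exprS EFinM; congr (_ * _).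
transitivity (lebesgue_measure `[tnth a ord0, (tnth a ord0 + s)%R[%classic) => //.
by rewrite lebesgue_measure_itv/= lte_fin ltrDl s0 -EFinD addrAC subrr add0r.
Qed.

Lemma dyadic_grid_cube N (D : set (set (tupleR R N))) Q :
  dyadic_grid D -> D Q -> exists a s, (0 < s)%R /\ Q = cube a s.
Proof.
move=> [lam [lam0 cub _ _]] /cub[k [a ->]]; exists a, (lam * 2 ^ k)%R.
by rewrite mulr_gt0// exprz_gt0.
Qed.

Lemma dyadic_grid_nonempty N (D : set (set (tupleR R N))) Q :
  dyadic_grid D -> D Q -> Q !=set0.
Proof.
move=> dD DQ; have [a [s [s0 ->]]] := dyadic_grid_cube dD DQ.
by exists a => i /=; rewrite lexx ltrDl.
Qed.

(** Two cubes of equal side that share a point coincide, by the tiling property; for different sides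
    the ratio of the volumes is at least 2^N >= 2. *)
Lemma dyadic_grid_lacunary N (D : set (set (tupleR R N))) : (0 < N)%N ->
  dyadic_grid D -> lacunary (lebesgue_tuple N) D.
Proof.
move=> N0 dD; split.
- by move=> Q /(dyadic_grid_cube dD)[a [s [_ ->]]]; exact: measurable_cube.
- move=> Q /(dyadic_grid_cube dD)[a [s [s0 ->]]].
  by rewrite lebesgue_cube// lte_fin exprn_gt0//= ltry.
have [lam [lam0 cub part _]] := dD.
move=> Q Q' x DQ DQ' QQ' Qx Q'x.
have [k [a Qk]] := cub _ DQ; have [k' [a' Qk']] := cub _ DQ'.
have pos j : (0 < lam * 2 ^ j)%R by rewrite mulr_gt0// exprz_gt0.
have [kk'|kk'] := eqVneq k k'.
  have [_ tI] := part k; exfalso; move/eqP: QQ'; apply.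
  apply: (tI Q Q'); first by split => //; exists a.
    by split => //; exists a'; rewrite kk'.
  by exists x.
have H (j j' : int) : (j < j')%R ->
    (2 * (lam * 2 ^ j) ^+ N <= (lam * 2 ^ j') ^+ N)%R.
  move=> jj'.
  have d1 : (2 * (lam * 2 ^ j) <= lam * 2 ^ j')%R.
    rewrite mulrCA ler_pM2l// -[X in (X * _)%R]expr1z -expfzDr ?pnatr_eq0//.
    by rewrite ler_eXz2l ?ltr1n// addrC lezD1.
  apply: le_trans (_ : (2 * (lam * 2 ^ j)) ^+ N <= _)%R.
    rewrite [leRHS]exprMn ler_wpM2r ?exprn_ge0 ?(ltW (pos j))//.
    by rewrite -{1}[2%R]expr1 ler_weXn2l// ler1n.
  apply: lerXn2r d1; rewrite nnegrE; last exact/ltW/pos.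
  by apply: mulr_ge0 => //; exact/ltW/pos.
rewrite Qk Qk' !lebesgue_cube// -!EFinM !lee_fin.
by case: (ltgtP k k') kk' => // h _; [left|right]; exact: H.
Qed.

End cubes.

(** * The embedding for a partial grid *)

Section embedding.
Variables (R : realType) (m n : nat).
Local Open Scope ereal_scope.

Lemma dx_rectangle (I : set (tupleR R m)) (J : set (tupleR R n)) :
  measurable I -> measurable J ->
  dx (I `*` J : set (lebR R m n)) =
    (lebesgue_tuple m : {measure set _ -> \bar R}) I *
    (lebesgue_tuple n : {measure set _ -> \bar R}) J.
Proof.
move=> mI mJ /=; rewrite -[RHS]product_measure1E//.
by apply: completionE; exact: measurableX.
Qed.

Variables (Dm : set (set (tupleR R m))) (Dn : set (set (tupleR R n))).
Hypotheses (m0 : (0 < m)%N) (n0 : (0 < n)%N).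
Hypotheses (dDm : dyadic_grid Dm) (dDn : dyadic_grid Dn).

Lemma partial_grid_measure Q : partial_grid Dm Dn Q ->
  measurable Q /\ exists2 r : R, (0 < r)%R & dx Q = r%:E.
Proof.
move=> [I [J [DI DJ ->]]].
have [a [s [s0 ->]]] := dyadic_grid_cube dDm DI.
have [b [t [t0 ->]]] := dyadic_grid_cube dDn DJ.
have ma := measurable_cube a s; have mb := measurable_cube b t.
split; first by apply: measurable_completion; exact: measurableX.
exists (s ^+ m * t ^+ n)%R; first by rewrite mulr_gt0// exprn_gt0.
by rewrite dx_rectangle// !lebesgue_cube.
Qed.

(** Pass to a Borel representative of [f], then reindex the rectangles by their pairs of sides to
    reach [product_embedding]. *)
Lemma partial_grid_embedding (S rho : R) (f : lebR R m n -> \bar R) :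
  (1 < S)%R -> (S < rho)%R ->
  measurable_fun setT f -> (forall x, 0 <= f x) ->
  \esum_(Q in partial_grid Dm Dn) (scaled_int dx S Q f `^ rho) <=
  (2 `^ rho * embed_const S rho ^+ 2)%:E * (\int[dx]_x (f x `^ S)) `^ (rho / S).
Proof.
move=> S1 Srho mf f0.
have S0 : (0 < S)%R by exact: lt_trans S1.
have rho0 : (0 < rho)%R by exact: lt_trans Srho.
have C0 : (0 < 2 `^ rho * embed_const S rho ^+ 2)%R.
  by rewrite mulr_gt0 ?powR_gt0// exprn_gt0// embed_const_gt0.
have lm := dyadic_grid_lacunary m0 dDm; have ln := dyadic_grid_lacunary n0 dDn.
have [Iy|Iy] := eqVneq (\int[dx]_x (f x `^ S)) +oo.
  by rewrite Iy poweRyr ?gt0_muley ?lte_fin ?leey// gt_eqF// divr_gt0.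
have [|g [mg g0 Ig IQ]] := completion_integrals S0 mf f0.
  by rewrite lt_neqAle leey andbT.
rewrite Ig; apply: le_trans (product_embedding lm ln S1 Srho mg g0).
pose e (k : set (tupleR R m) * set (tupleR R n)) : set (lebR R m n) := k.1 `*` k.2.
have GE : partial_grid Dm Dn = e @` (Dm `*`` (fun=> Dn)).
  apply/seteqP; split => [Q [I [J [DI DJ ->]]]|_ [[I J] [/= DI DJ] <-]].
    by exists (I, J).
  by exists I, J.
(* The sides can be read off a rectangle because both are nonempty, so the reindexing is
   injective. *)
rewrite GE esum_image; last first.
  move=> [I J] [I' J'] /set_mem[/= DI DJ] /set_mem[/= DI' DJ'] /= E.
  have [x Ix] := dyadic_grid_nonempty dDm DI.
  have [y Jy] := dyadic_grid_nonempty dDn DJ.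
  have P z : (I `*` J) z <-> (I' `*` J') z by rewrite -/(e (I, J)) E.
  have [I'x J'y] : I' x /\ J' y by apply/(P (x, y)).
  congr pair; apply/seteqP; split => z h.
  - by have [] : (I' `*` J') (z, y) by apply/P.
  - by have [] : (I `*` J) (z, y) by apply/P.
  - by have [] : (I' `*` J') (x, z) by apply/P.
  - by have [] : (I `*` J) (x, z) by apply/P.
rewrite esum_esum; last by move=> *; exact: poweR_ge0.
apply: le_esum => -[I J] [/= DI DJ].
have mI : measurable I by have [+ _ _] := lm; exact.
have mJ : measurable J by have [+ _ _] := ln; exact.
rewrite /scaled_int dx_rectangle// IQ; last exact: measurableX.
by rewrite [_ `^ (S^-1 - 1)]poweRM.
Qed.

End embedding.

(** * Measures with a density *)

Section density.
Context d (T : measurableType d) (R : realType).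
Variables (mu nu : {measure set T -> \bar R}) (s : T -> \bar R).
Local Open Scope ereal_scope.
Hypotheses (ms : measurable_fun setT s) (s0 : forall x, 0 <= s x).
Hypothesis nuE : forall A, measurable A -> nu A = \int[mu]_(x in A) s x.
Import HBNNSimple.

(** Linearity reduces simple functions to indicators, for which the identity is [nuE]. *)
Let integral_density_nnsfun (E : set T) (h : {nnsfun T >-> R}) : measurable E ->
  \int[mu]_(x in E) ((h x)%:E * s x) = \int[nu]_(x in E) (h x)%:E.
Proof.
move=> mE.
have msE : measurable_fun E s by exact: measurable_funTS.
transitivity (\int[nu]_(x in E)
   (\sum_(y \in range h) (y * \1_(h @^-1` [set y]) x)%:E)); last first.
  by apply: eq_integral => t tE; rewrite /= fimfunE -fsumEFin.
have indich r : measurable_fun E (fun x => (r * \1_(h @^-1` [set r]) x)%:E).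
  by apply: (measurable_comp measurableT) => //; exact: measurable_funM.
rewrite ge0_integral_fsum//; last by move=> m y Ey; exact: nnfun_muleindic_ge0.
transitivity (\int[mu]_(x in E) (\sum_(y \in range h)
    (y * \1_(h @^-1` [set y]) x)%:E * s x)).
  under [RHS]eq_integral => x xE.
    rewrite -ge0_mule_fsuml => [|y]; last exact: nnfun_muleindic_ge0.
    rewrite fsumEFin // -(fimfunE _ x); over.
  by [].
rewrite ge0_integral_fsum//; last 2 first.
  - by move=> y; exact: emeasurable_funM.
  - by move=> y x Ex; rewrite mule_ge0// nnfun_muleindic_ge0.
apply: eq_fsbigr => r rhn.
under [RHS]eq_integral do rewrite EFinM.
rewrite integralZl_indic_nnsfun => //.
under eq_integral do rewrite EFinM -muleA.
rewrite ge0_integralZl//.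
- under eq_integral do rewrite muleC.
  rewrite (eq_integral (s \_ (h @^-1` [set r]))); last first.
    by move=> x xE; rewrite epatch_indic.
  by rewrite -integral_mkcondr -nuE ?integral_indic 1?setIC//; exact: measurableI.
- apply: emeasurable_funM => //; exact/measurable_EFinP.
- by move=> t Et; rewrite mule_ge0 ?lee_fin.
- by move: rhn; rewrite inE => -[t _ <-]; rewrite lee_fin.
Qed.

(** Monotone convergence along simple approximations. The density may be infinite, as v^(-p') is
    where v vanishes. *)
Lemma ge0_integral_density (E : set T) (f : T -> \bar R) : measurable E ->
  measurable_fun setT f -> (forall x, 0 <= f x) ->
  \int[nu]_(x in E) f x = \int[mu]_(x in E) (f x * s x).
Proof.
move=> mE mf f0.
have msE : measurable_fun E s by exact: measurable_funTS.
pose h := nnsfun_approx measurableT mf.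
have hf x : EFin \o h ^~ x @ \oo --> f x.
  by apply: cvg_nnsfun_approx => //.
have nh x : {homo (fun n => h n x) : a b / (a <= b)%N >-> (a <= b)%R}.
  by move=> a b ab; exact/lefP/nd_nnsfun_approx.
have fsup x : f x = ereal_sup (range (fun n => (h n x)%:E)).
  have nhx : {homo (fun n => (h n x)%:E) : a b / (a <= b)%N >-> a <= b}.
    by move=> a b ab; rewrite lee_fin nh.
  rewrite -(cvg_lim _ (hf x))//; apply/cvg_lim => //.
  exact: (ereal_nondecreasing_cvgn nhx).
have hs x : (fun n => (h n x)%:E * s x) @ \oo --> f x * s x.
  (* Where the density is +oo, the products are all 0 if f(x) = 0, by 0 * oo = 0, and are eventually
     +oo if f(x) > 0. *)
  have [sy|sy] := eqVneq (s x) +oo; last first.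
    apply: cvgeZr; first by rewrite ge0_fin_numE// lt_neqAle sy leey.
    exact: hf.
  have [fx0|fx0] := eqVneq (f x) 0.
    have -> : (fun n => (h n x)%:E * s x) = cst (f x * s x); last exact: cvg_cst.
    apply/funext => n /=; rewrite fx0 mul0e.
    have -> : (h n x)%:E = 0; last by rewrite mul0e.
    apply/eqP; rewrite eq_le; apply/andP; split; last by rewrite lee_fin.
    rewrite -[leRHS]fx0.
    by rewrite fsup; apply: ereal_sup_ubound; exists n.
  have fp : 0 < f x by rewrite lt0e fx0 f0.
  rewrite sy gt0_muley//.
  have [N hN] : exists N, (0 < h N x)%R.
    apply/not_existsP => hN; move: fp; rewrite fsup ltNge => /negP; apply.
    apply: ge_ereal_sup => _ [n _ <-]; rewrite lee_fin leNgt; exact/negP/hN.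
  apply: cvg_near_cst; exists N => // n /= Nn.
  by rewrite gt0_muley// lte_fin (lt_le_trans hN)// nh.
transitivity (limn (fun n => \int[nu]_(x in E) (h n x)%:E)).
  rewrite -monotone_convergence//.
  - by apply: eq_integral => x _; apply/esym/cvg_lim => //; exact: hf.
  - by move=> n; apply/measurable_EFinP/measurable_funTS/measurable_funP.
  - by move=> n x _; rewrite lee_fin.
  - by move=> x _ a b ab; rewrite lee_fin nh.
transitivity (limn (fun n => \int[mu]_(x in E) ((h n x)%:E * s x))).
  by congr (limn _); apply/funext => n; rewrite integral_density_nnsfun.
rewrite -monotone_convergence//.
- by apply: eq_integral => x _; apply/cvg_lim => //; exact: hs.
- by move=> n; apply: emeasurable_funM => //;
  apply/measurable_EFinP/measurable_funTS/measurable_funP.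
- by move=> n x _; rewrite mule_ge0// lee_fin.
- by move=> x _ a b ab; rewrite lee_wpmul2r// lee_fin nh.
Qed.
End density.

(** * Bumps *)

Section conjugate_exponents.
Variable R : realType.
Implicit Types p : R.

Lemma conj_expV p : 1 < p -> (conj_exp p)^-1 = 1 - p^-1.
Proof.
move=> p1; rewrite /conj_exp; field.
by rewrite (gt_eqF (lt_trans ltr01 p1))//= subr_eq0 gt_eqF.
Qed.

Lemma conj_exp_gt1 p : 1 < p -> 1 < conj_exp p.
Proof.
by move=> p1; rewrite /conj_exp ltr_pdivlMr ?subr_gt0// mul1r ltrBlDr ltrDl ltr01.
Qed.

End conjugate_exponents.

Section bump_hoelder.
Context d (T : measurableType d) (R : realType).
Variables (mu : {measure set T -> \bar R}) (p P theta : R).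
Hypotheses (p1 : 1 < p) (P1 : 1 < P) (pP : p^-1 + P^-1 = 1) (theta1 : 1 < theta).
Local Open Scope ereal_scope.

(** The Hoelder exponent a conjugate to P theta. As P theta > P, it lies below the conjugate p of
    P. *)
Definition bump_exp : R := conj_exp (P * theta).

Let Pt1 : (1 < P * theta)%R.
Proof. by rewrite (lt_trans P1)// ltr_pMr// (lt_trans ltr01). Qed.

Let aV : (bump_exp^-1 = 1 - (P * theta)^-1)%R.
Proof. exact: conj_expV. Qed.

Lemma bump_exp_gt1 : (1 < bump_exp)%R. Proof. exact: conj_exp_gt1. Qed.

Let a0 : (0 < bump_exp)%R. Proof. exact: lt_trans bump_exp_gt1. Qed.

Lemma bump_exp_lt : (1 < p / bump_exp)%R.
Proof.
have P0 : (0 < P)%R by exact: lt_trans P1.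
have p0 : (0 < p)%R by exact: lt_trans p1.
rewrite -ltr_pdivrMl// mulr1 aV (_ : p^-1 = 1 - P^-1)%R ?ltrD2l ?ltrN2; last first.
  by rewrite -pP addrK.
by rewrite ltf_pV2 ?posrE// ?ltr_pMr// (lt_trans ltr01 Pt1).
Qed.

(** The function Phi = F^a with F = f s^(1/p); its L^(p/a) norm encodes the L^p norm of [f] with
    respect to s dx. *)
Definition bump_fun (f s : T -> \bar R) : T -> \bar R :=
  fun x => (f x * s x `^ p^-1) `^ bump_exp.

Lemma bump_fun_ge0 f s x : 0 <= bump_fun f s x.
Proof. exact: poweR_ge0. Qed.

Lemma measurable_bump_fun f s : measurable_fun setT f -> measurable_fun setT s ->
  measurable_fun setT (bump_fun f s).
Proof.
move=> mf ms; apply: measurable_fun_poweR; apply: emeasurable_funM => //.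
exact: measurable_fun_poweR.
Qed.

Lemma integral_bump_fun f s : (forall x, 0 <= f x) -> (forall x, 0 <= s x) ->
  \int[mu]_x (bump_fun f s x `^ (p / bump_exp)) = \int[mu]_x (f x `^ p * s x).
Proof.
move=> f0 s0; apply: eq_integral => x _.
have p0 : (0 < p)%R by exact: lt_trans p1.
rewrite /bump_fun -poweRrM mulrCA divff ?mulr1 ?gt_eqF//.
by rewrite poweRM ?poweR_ge0// poweRVK.
Qed.

(** Write s = s^(1/p) s^(1/P), keep the first factor with [f], and apply Hoelder with exponents a
    and P theta. *)
Lemma bump_hoelder (Q : set T) (f s : T -> \bar R) (del : R) :
  measurable Q -> mu Q = del%:E -> (0 < del)%R ->
  measurable_fun setT f -> measurable_fun setT s ->
  (forall x, 0 <= f x) -> (forall x, 0 <= s x) ->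
  \int[mu]_(x in Q) (f x * s x) <=
    2%:E * ((mu Q `^ (P * conj_exp theta)^-1 *
             (\int[mu]_(x in Q) (s x `^ theta)) `^ (P * theta)^-1) *
            scaled_int mu (p / bump_exp) Q (bump_fun f s) `^ bump_exp^-1).
Proof.
move=> mQ muQ del0 mf ms f0 s0.
have P0 : (0 < P)%R by exact: lt_trans P1.
have p0 : (0 < p)%R by exact: lt_trans p1.
have t0 : (0 < theta)%R by exact: lt_trans theta1.
have msP r : measurable_fun setT (fun x => s x `^ r) by exact: measurable_fun_poweR.
have mF : measurable_fun setT (fun x => f x * s x `^ p^-1) by exact: emeasurable_funM.
have -> : \int[mu]_(x in Q) (f x * s x) =
    \int[mu]_(x in Q) ((f x * s x `^ p^-1) * s x `^ P^-1).
  apply: eq_integral => x _; rewrite -muleA -poweRD ?pP ?poweRe1//.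
  by rewrite add_neq0_poweRD_def// pP oner_neq0.
have Pt0 : (0 < P * theta)%R by rewrite mulr_gt0.
have aPt : (bump_exp^-1 + (P * theta)^-1 = 1)%R by rewrite aV subrK.
have := @ge0_hoelder _ _ _ mu Q (fun x => f x * s x `^ p^-1) (fun x => s x `^ P^-1)
  bump_exp (P * theta)%R mQ (measurable_funTS mF) (measurable_funTS (msP _)).
move=> /(_ _ _ a0 Pt0 aPt) H.
apply: le_trans (H _ _) _.
- by move=> x; rewrite mule_ge0// poweR_ge0.
- by move=> x; exact: poweR_ge0.
rewrite [X in _ * (_ * X `^ _)](eq_integral (fun x => s x `^ theta)); last first.
  by move=> x _; rewrite -poweRrM mulrA mulVf ?mul1r// gt_eqF.
rewrite lee_wpmul2l ?lee_fin// [leRHS]muleAC [leRHS]muleC [leRHS]muleC.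
rewrite lee_wpmul2r ?poweR_ge0//.
rewrite /scaled_int poweRM ?poweR_ge0//; last first.
  by apply: integral_ge0 => x _; exact: bump_fun_ge0.
rewrite muleA muQ !poweR_EFin -EFinM -powRrM -powRD ?(gt_eqF del0) ?implybT//.
(* The powers of the measure cancel: 1/(P theta') + (a/p - 1)/a = 1/(P theta') + 1/p - 1/a = 0. *)
rewrite (_ : _ + _ = 0)%R ?powRr0 ?mul1e//.
rewrite invf_div mulrBl mulrAC divff ?gt_eqF// mul1r aV invfM conj_expV// invfM.
have -> : (p^-1 = 1 - P^-1)%R by rewrite -pP addrK.
by ring.
Qed.

End bump_hoelder.

Section embedding_norm.
Variables (R : realType) (m n : nat).
Variables (Dm : set (set (tupleR R m))) (Dn : set (set (tupleR R n))).
Hypotheses (m0 : (0 < m)%N) (n0 : (0 < n)%N).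
Hypotheses (dDm : dyadic_grid Dm) (dDn : dyadic_grid Dn).
Local Open Scope ereal_scope.

Definition bump_const (p P theta r : R) : R :=
  let a := bump_exp P theta in
  ((2 `^ (r / a) * embed_const (p / a) (r / a) ^+ 2) `^ r^-1)%R.

(** This is [partial_grid_embedding] for Phi with S = p/a and rho = r/a, followed by the r-th root.
    The final exponent is rho/(S r) = 1/p, and p < r gives S < rho. *)
Lemma bump_embedding (p P theta r : R) (s f : lebR R m n -> \bar R)
    (nu : {measure set (lebR R m n) -> \bar R}) :
  (1 < p)%R -> (1 < P)%R -> (p^-1 + P^-1 = 1)%R -> (1 < theta)%R -> (p < r)%R ->
  measurable_fun setT s -> (forall x, 0 <= s x) ->
  (forall A, measurable A -> nu A = \int[dx]_(x in A) s x) ->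
  measurable_fun setT f -> (forall x, 0 <= f x) ->
  (\esum_(Q in partial_grid Dm Dn)
    ((scaled_int dx (p / bump_exp P theta) Q (bump_fun p P theta f s)
       `^ (bump_exp P theta)^-1) `^ r)) `^ r^-1 <=
  (bump_const p P theta r)%:E * Lnorm nu p%:E f.
Proof.
move=> p1 P1 pP theta1 pr ms s0 nuE mf f0.
have p0 : (0 < p)%R by exact: lt_trans p1.
have r0 : (0 < r)%R by exact: lt_trans pr.
set a := bump_exp P theta.
have a0 : (0 < a)%R by apply: lt_trans (bump_exp_gt1 P1 theta1).
have S1 := bump_exp_lt p1 P1 pP theta1; rewrite -/a in S1.
have Sr : (p / a < r / a)%R by rewrite ltr_pM2r ?invr_gt0.
have mPhi := measurable_bump_fun p P theta mf ms.
have Phi0 := bump_fun_ge0 p P theta f s.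
have H := partial_grid_embedding m0 n0 dDm dDn S1 Sr mPhi Phi0.
have C0 : (0 <= 2 `^ (r / a) * embed_const (p / a) (r / a) ^+ 2)%R.
  by rewrite mulr_ge0 ?powR_ge0// exprn_ge0// ltW// embed_const_gt0.
apply: le_trans (gee0_ler_poweR _ _ (le_trans _ H)) _.
- by rewrite invr_ge0 ltW.
- by apply: esum_ge0 => *; exact: poweR_ge0.
- by apply: le_esum => Q _; rewrite -poweRrM [(r / a)%R]mulrC.
rewrite poweRM ?poweR_ge0// ?lee_fin// poweR_EFin.
rewrite lee_wpmul2l ?lee_fin ?powR_ge0//.
rewrite integral_bump_fun// -poweRrM unlock.
rewrite (_ : r / a / (p / a) / r = p^-1)%R; last first.
  by field; rewrite !gt_eqF.
have mfp : measurable_fun setT (fun x => f x `^ p) by exact: measurable_fun_poweR.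
have fp0 x : 0 <= f x `^ p by exact: poweR_ge0.
have -> : \int[nu]_x (`|f x| `^ p) = \int[nu]_x (f x `^ p).
  by apply: eq_integral => x _; rewrite gee0_abs.
by have -> := ge0_integral_density ms s0 nuE measurableT mfp fp0.
Qed.

End embedding_norm.

Lemma measurable_fun_inve d (T : measurableType d) (R : realType)
    (f : T -> \bar R) : measurable_fun setT f -> (forall x, 0 <= f x)%E ->
  measurable_fun setT (fun x => inve (f x)).
Proof.
move=> mf f0.
have -> : (fun x => inve (f x)) =
    (fun x => if (f x <= 0)%E then +oo%E else (fine (f x) `^ (-1))%:E).
  apply/funext => x; case: (f x) (f0 x) => [r|_|//]; last first.
    by rewrite invey /= powR0// oppr_eq0 oner_eq0.
  rewrite lee_fin /= => r0; rewrite lee_fin inver powR_inv1//.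
  by rewrite [(r <= 0)%R]le_eqVlt ltNge r0 orbF.
apply: measurable_fun_ifT => //; first exact: measurable_fun_lee.
apply/measurable_EFinP/(measurableT_comp (measurable_powR _)).
exact: measurableT_comp.
Qed.

Lemma mule_double_pairs (R : realType) (k b c x y : \bar R) :
  (k * (2%:E * (b * x) * (2%:E * (c * y))) =
   4%:E * ((k * (b * c)) * (x * y)))%E.
Proof.
rewrite (muleACA 2%:E) (muleACA b) (muleCA k) (muleA k); congr (_ * _)%E.
by rewrite -EFinM -natrM.
Qed.

(** * The bilinear form *)

Section bump_bilinear.
Variables (R : realType) (m n : nat).
Variables (Dm : set (set (tupleR R m))) (Dn : set (set (tupleR R n))).
Hypotheses (m0 : (0 < m)%N) (n0 : (0 < n)%N).
Hypotheses (dDm : dyadic_grid Dm) (dDn : dyadic_grid Dn).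
Variables (K : set (lebR R m n) -> R) (p q theta : R).
Hypotheses (p1 : 1 < p) (pq : p < q) (theta1 : 1 < theta).
Let G := partial_grid Dm Dn.
Local Open Scope ereal_scope.

Lemma poweR_theta_bump (u : lebR R m n -> \bar R) (P : R) Q :
  theta_bump theta u Q `^ P^-1 =
  dx Q `^ (P * conj_exp theta)^-1 *
  (\int[dx]_(x in Q) (u x `^ theta)) `^ (P * theta)^-1.
Proof.
rewrite /theta_bump; set I := integral _ _ _.
rewrite poweRM ?poweR_ge0// -!poweRrM -!invfM.
by rewrite ![(_ * P)%R]mulrC.
Qed.

(** The factor 8 collects three Hoelder constants 2: one for each function on a rectangle and one
    for the sum over rectangles. *)
Definition bilinear_const (r : R) : R :=
  (8 * (bump_const p (conj_exp p) theta r *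
        bump_const (conj_exp q) q theta (conj_exp r)))%R.

(** An exponent r strictly between p and q makes both embeddings strict: p < r for [f], and q' < r'
    for [g]. The sequences [x] and [y] are then paired by Hoelder in l^r and l^r'. *)
Lemma bump_bilinear (r A : R) (s o : lebR R m n -> \bar R)
    (sigma omega : {measure set (lebR R m n) -> \bar R}) :
  (p < r < q)%R -> (0 <= A)%R ->
  measurable_fun setT s -> (forall x, 0 <= s x) ->
  measurable_fun setT o -> (forall x, 0 <= o x) ->
  (forall E, measurable E -> sigma E = \int[dx]_(x in E) s x) ->
  (forall E, measurable E -> omega E = \int[dx]_(x in E) o x) ->
  (forall Q, G Q -> (0 <= K Q)%R) ->
  (forall Q, G Q -> (K Q)%:E * theta_bump theta o Q `^ q^-1 *
     theta_bump theta s Q `^ (conj_exp p)^-1 <= A%:E) ->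
  bilinear_ineq G K p q sigma omega (A * bilinear_const r)%R.
Proof.
move=> /andP[pr rq] A0 ms s0 mo o0 sigmaE omegaE K0 KA f g mf mg f0 g0.
have q1 := lt_trans p1 pq.
have r1 := lt_trans p1 pr.
have r0 : (0 < r)%R := lt_trans ltr01 r1.
pose P := conj_exp p; pose q' := conj_exp q; pose r' := conj_exp r.
have P1 : (1 < P)%R by exact: conj_exp_gt1.
have q'1 : (1 < q')%R by exact: conj_exp_gt1.
have r'0 : (0 < r')%R by exact: lt_trans (conj_exp_gt1 r1).
have pP : (p^-1 + P^-1 = 1)%R by rewrite conj_expV// addrC subrK.
have qq' : (q'^-1 + q^-1 = 1)%R by rewrite conj_expV// subrK.
have rr' : (r^-1 + r'^-1 = 1)%R by rewrite conj_expV// addrC subrK.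
have q'r' : (q' < r')%R.
  rewrite -ltf_pV2 ?posrE//; last exact: lt_trans ltr01 q'1.
  rewrite !conj_expV// ltrD2l ltrN2 ltf_pV2 ?posrE//; exact: lt_trans ltr01 q1.
pose C1 := bump_const p P theta r; pose C2 := bump_const q' q theta r'.
have C10 : (0 <= C1)%R by exact: powR_ge0.
have C20 : (0 <= C2)%R by exact: powR_ge0.
pose x Q := scaled_int dx (p / bump_exp P theta) Q (bump_fun p P theta f s)
       `^ (bump_exp P theta)^-1.
pose y Q := scaled_int dx (q' / bump_exp q theta) Q (bump_fun q' q theta g o)
       `^ (bump_exp q theta)^-1.
have x0 Q : 0 <= x Q by exact: poweR_ge0.
have y0 Q : 0 <= y Q by exact: poweR_ge0.
have term Q : G Q ->
    (K Q)%:E * \int[sigma]_(x in Q) f x * \int[omega]_(x in Q) g x <=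
    (4 * A)%:E * (x Q * y Q).
  move=> GQ; have [mQ [del del0 dQ]] := partial_grid_measure dDm dDn GQ.
  have fE := ge0_integral_density ms s0 sigmaE mQ mf f0.
  have gE := ge0_integral_density mo o0 omegaE mQ mg g0.
  have h1 := bump_hoelder p1 P1 pP theta1 mQ dQ del0 mf ms f0 s0.
  have h2 := bump_hoelder q'1 q1 qq' theta1 mQ dQ del0 mg mo g0 o0.
  rewrite -fE -poweR_theta_bump -/(x Q) in h1.
  rewrite -gE -poweR_theta_bump -/(y Q) in h2.
  have KQ : 0 <= (K Q)%:E by rewrite lee_fin K0.
  have f1 : 0 <= \int[sigma]_(x in Q) f x by exact: integral_ge0.
  have g1 : 0 <= \int[omega]_(x in Q) g x by exact: integral_ge0.
  rewrite -muleA; apply: le_trans (lee_wpmul2l KQ (lee_pmul f1 g1 h1 h2)) _.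
  rewrite mule_double_pairs (EFinM 4) -(muleA 4%:E) lee_wpmul2l ?lee_fin//.
  by rewrite lee_wpmul2r ?mule_ge0// muleA muleAC KA.
apply: le_trans (le_esum term) _.
have A4 : 0 <= (4 * A)%:E by rewrite lee_fin mulr_ge0.
have xy0 Q : G Q -> 0 <= x Q * y Q by move=> _; exact: mule_ge0.
apply: le_trans (esumZl_le A4 xy0) _.
have xN := bump_embedding m0 n0 dDm dDn p1 P1 pP theta1 pr ms s0 sigmaE mf f0.
have yN := bump_embedding m0 n0 dDm dDn q'1 q1 qq' theta1 q'r' mo o0 omegaE mg g0.
have h := esum_hoelder (D := G) (fun Q _ => x0 Q) (fun Q _ => y0 Q) r0 r'0 rr'.
apply: le_trans (lee_wpmul2l A4 h) _.
have -> : (A * bilinear_const r = 4 * A * (2 * (C1 * C2)))%R.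
  by rewrite /bilinear_const -/C1 -/C2; ring.
rewrite (EFinM (4 * _)) (EFinM 2) (EFinM C1) -2!muleA lee_wpmul2l//.
rewrite -muleA lee_wpmul2l ?lee_fin// muleACA.
by apply: lee_pmul; [exact: poweR_ge0|exact: poweR_ge0|exact: xN|exact: yN].
Qed.

Lemma bilinear_const_ge0 r : (0 <= bilinear_const r)%R.
Proof. by rewrite mulr_ge0// mulr_ge0// powR_ge0. Qed.

Lemma bump_characteristicE (v w : lebR R m n -> \bar R) :
  bump_characteristic G K p q theta v w =
  ereal_sup [set (K Q)%:E *
        theta_bump theta (fun x => w x `^ q) Q `^ q^-1 *
        theta_bump theta (fun x => inve (v x) `^ conj_exp p) Q `^ (conj_exp p)^-1
      | Q in G].
Proof.
rewrite /bump_characteristic; congr ereal_sup; apply: eq_imagel => Q _.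
rewrite !poweR_theta_bump [RHS]muleAC.
have e (u : lebR R m n -> \bar R) (a : R) :
    \int[dx]_(x in Q) ((u x `^ a) `^ theta) = \int[dx]_(x in Q) (u x `^ (a * theta)).
  by apply: eq_integral => x _; rewrite poweRrM.
by rewrite (e w) (e (fun x => inve (v x))).
Qed.

End bump_bilinear.

Theorem theorem2 (R : realType) (m n : nat) (p q theta : R) :
  (0 < m)%N -> (0 < n)%N -> 1 < p -> p < q -> 1 < theta ->
  exists B : R -> R,
  forall (v w : lebR R m n -> \bar R)
    (sigma omega : {measure set (lebR R m n) -> \bar R})
    (Dm : set (set (tupleR R m))) (Dn : set (set (tupleR R n)))
    (K : set (lebR R m n) -> R),
  measurable_fun setT v -> measurable_fun setT w ->
  (forall x, 0 <= v x)%E -> (forall x, 0 <= w x)%E ->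
  (forall A, measurable A ->
     sigma A = \int[dx]_(x in A) (inve (v x) `^ conj_exp p))%E ->
  (forall A, measurable A -> omega A = \int[dx]_(x in A) (w x `^ q))%E ->
  locally_finite sigma -> locally_finite omega ->
  dyadic_grid Dm -> dyadic_grid Dn ->
  (forall Q, partial_grid Dm Dn Q -> 0 <= K Q) ->
  let G := partial_grid Dm Dn in
  let A := bump_characteristic G K p q theta v w in
  A = ereal_sup [set (K Q)%:E *
        theta_bump theta (fun x => w x `^ q) Q `^ q^-1 *
        theta_bump theta (fun x => inve (v x) `^ conj_exp p) Q `^ (conj_exp p)^-1
      | Q in G]%E
  /\ ((A < +oo)%E -> (best_constant G K p q sigma omega <= (B (fine A))%:E)%E).
Proof.
move=> m0 n0 p1 pq theta1.
have [r prq] : exists r, p < r < q.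
  by exists ((p + q) / 2); apply/andP; split; lra.
(* The bound is fixed before the weights, the grids and [K], and r depends on p and q only: this is
   the uniformity claimed. The absolute value keeps the constant nonnegative at every real
   argument. *)
exists (fun A => `|A| * bilinear_const p q theta r) => v w sigma omega Dm Dn K.
move=> mv mw v0 w0 sigmaE omegaE _ _ dDm dDn K0 G A.
have AE := bump_characteristicE Dm Dn K p q theta v w.
split; first exact: AE.
move=> Aoo; rewrite /best_constant; apply: ereal_inf_lbound.
have B0 := mulr_ge0 (normr_ge0 (fine A)) (bilinear_const_ge0 p q theta r).
exists (`|fine A| * bilinear_const p q theta r); last by [].
split; first exact: B0.
have ms := measurable_fun_poweR (conj_exp p) (measurable_fun_inve mv v0).
have mo := measurable_fun_poweR q mw.
have s0 x := poweR_ge0 (inve (v x)) (conj_exp p).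
have o0 x := poweR_ge0 (w x) q.
(* A rectangle of the grid gives a nonnegative term below the supremum, so the finite supremum
   equals the absolute value of its real part. *)
have KA Q : G Q -> ((K Q)%:E *
    theta_bump theta (fun x => w x `^ q) Q `^ q^-1 *
    theta_bump theta (fun x => inve (v x) `^ conj_exp p) Q `^ (conj_exp p)^-1
    <= `|fine A|%:E)%E.
  move=> GQ; set t := (_ * _ * _)%E.
  have tA : (t <= A)%E by rewrite /A AE; apply: ereal_sup_ubound; exists Q.
  have t0 : (0 <= t)%E by rewrite !mule_ge0 ?poweR_ge0// lee_fin K0.
  have A0 := le_trans t0 tA.
  by rewrite (le_trans tA)// -abse_EFin fineK ?gee0_abs// ge0_fin_numE.
exact: (bump_bilinear m0 n0 dDm dDn p1 pq theta1 prq (normr_ge0 _)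
  ms s0 mo o0 sigmaE omegaE K0 KA).
Qed.
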